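(* Let $\mathcal R = (\Sigma, E, R)$ be a rewrite theory and let $\Gamma_{\mathcal M}$ be the set of finite and infinite executions of the transition system $\mathcal M = (T_{\Sigma/E}, \to^1_R)$. For any $\infty$-recursively enumerable language $L \subseteq \Gamma_{\mathcal M}$, there is some strategy expression $\alpha$ such that $E(\alpha) = L$.
   Context: **Executions and languages.** An execution of $\mathcal M$ is a nonempty finite word $s_0\cdots s_n$ or an infinite word $s_0s_1\cdots$ of states with $s_k\to^1_R s_{k+1}$ for all consecutive states (any starting state). A language of finite and infinite words over a finite alphabet $A$ (here $A\subseteq T_{\Sigma/E}$ finite) is $\infty$-recursively enumerable if its finite words form a recursively enumerable language and its infinite words form an $\omega$-recursively enumerable language, i.e. the language accepted by a nondeterministic Turing machine with a Büchi condition: with input $w\in A^\omega$ written on its one-way infinite tape, $w$ is accepted if there is an infinite run that is complete (every tape position is visited at some time) and visits states of a given set $F$ infinitely often. **Strategy expression.** The expression $\alpha$ may call (recursive) strategies defined in a strategy module, which may rely on auxiliary equationally defined data types in a protecting extension of $(\Sigma,E)$ that changes neither the terms in $T_\Sigma$ nor their rewriting. **Rewriting.** $\mathcal R = (\Sigma, E, R)$ is a rewrite theory over a membership equational theory $(\Sigma,E)$, with labeled rules, possibly conditional, with condition fragments that are equations, sort memberships, or rewriting conditions $l \Rightarrow p$. Terms are considered modulo $E$; $T_\Sigma$ denotes ground terms and $T_{\Sigma/E}$ their classes modulo $E$ (brackets are omitted). $t \to^1_R t'$ is one-step rewriting. **Strategy expressions.** Core grammar: $\alpha ::= \mathtt{idle}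 \mid \mathtt{fail} \mid \mathtt{match}\,P\,\mathtt{s.t.}\,C \mid \alpha;\alpha \mid \alpha|\alpha \mid \alpha^* \mid \alpha\,?\,\alpha:\alpha \mid \mathtt{matchrew}\,P\,\mathtt{s.t.}\,C\,\mathtt{by}\,x_1\,\mathtt{using}\,\alpha_1,\ldots,x_n\,\mathtt{using}\,\alpha_n \mid sl(t_1,\ldots,t_n) \mid \mathtt{all} \mid rl[\rho]\{\alpha_1,\ldots,\alpha_m\}$, where $C$ is an equational condition, $rl$ is a rule label, $\rho$ is an optional initial substitution $x_1 \leftarrow t_1,\ldots$, the list of $m\ge0$ strategies is for a rule with $m$ rewriting conditions, and $sl$ is a strategy name given by definitions $sl(p_1,\ldots,p_n) := \delta$ (optionally: if an equational condition holds), which may be mutually recursive. Rule applications may be wrapped in $\mathtt{top}(\cdot)$ to apply only at the root. (Variants $\mathtt{amatch}$, $\mathtt{amatchrew}$ match at any position; $\mathtt{xmatch}$, $\mathtt{xmatchrew}$ match with extension.) Other combinators are abbreviations. **Execution states** $\mathcal{XS}$: $q ::= t \mathbin{@} s \mid \mathrm{subterm}(x_1:q_1,\ldots,x_n:q_n;t)\mathbin{@} s \mid \mathrm{rewc}(p:q,\sigma,C,\vec\alpha,\theta,r,c;t)\mathbin{@} s$, with stacks $s ::= \varepsilon \mid \alpha s \mid \theta s$ of strategy expressions $\alpha$ and substitutions $\theta$. $\mathrm{vctx}(\theta s)=\theta$, $\mathrm{vctx}(\varepsilon)=\mathrm{id}$, $\mathrm{vctx}(\alpha s)=\mathrm{vctx}(s)$.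 Current term: $\mathrm{cterm}(t\mathbin{@} s)=t$, $\mathrm{cterm}(\mathrm{rewc}(\ldots;t)\mathbin{@} s)=t$, $\mathrm{cterm}(\mathrm{subterm}(x_1:q_1,\ldots,x_n:q_n;t)\mathbin{@} s)=t[x_1/\mathrm{cterm}(q_1),\ldots,x_n/\mathrm{cterm}(q_n)]$. States $t\mathbin{@}\varepsilon$ are solutions. **Transitions** ($\to_c$ control, $\to_s$ system, $\to_{s,c} = \to_s\cup\to_c$), where $\theta=\mathrm{vctx}(s)$ instantiates the variables of the expressions: - $t\mathbin{@}\mathtt{idle}\,s\to_c t\mathbin{@} s$; no rule for $\mathtt{fail}$; $t\mathbin{@}\theta' s\to_c t\mathbin{@} s$ (popping a substitution). - $t\mathbin{@}(\mathtt{match}\,P\,\mathtt{s.t.}\,C)\,s\to_c t\mathbin{@} s$ if $t$ matches $P$ satisfying $C$. - $t\mathbin{@}(\alpha;\beta)s\to_c t\mathbin{@}\alpha\beta s$; $t\mathbin{@}(\alpha|\beta)s\to_c t\mathbin{@}\alpha s$ and $\to_c t\mathbin{@}\beta s$; $t\mathbin{@}\alpha^* s\to_c t\mathbin{@} s$ and $\to_c t\mathbin{@}\alpha\,\alpha^* s$. - $t\mathbin{@}(\alpha?\beta:\gamma)s\to_c t\mathbin{@}\alpha\beta s$; and $t\mathbin{@}(\alpha?\beta:\gamma)s\to_c t\mathbin{@}\gamma s$ if $\to_{s,c}$ is terminating from $t\mathbin{@}\alpha\theta$ and reaches no solution from it. - $t\mathbin{@}\mathtt{all}\,s\to_s t'\mathbin{@}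 s$ if $t\to^1_R t'$. For a rule labeled $rl$ without rewriting conditions, $t\mathbin{@} rl[\rho]s\to_s t'\mathbin{@} s$ for each $t'$ obtained from $t$ by applying, at some position, that rule instantiated first by $\rho$ (whose terms are instantiated by $\theta$). - For a rule labeled $rl$ with right-hand side $r$ and condition $C_0\wedge l_1\Rightarrow p_1\wedge C'$ with $C_0$ equational and $m\ge1$ rewriting fragments in total: $t\mathbin{@} rl[\rho]\{\alpha_1,\ldots,\alpha_m\}s\to_c\mathrm{rewc}(p_1:\sigma(l_1)\mathbin{@}\alpha_1\theta,\sigma,C',\alpha_2\cdots\alpha_m,\theta,r,c;t)\mathbin{@} s$ for each context $c$ and substitution $\sigma$ (extending $\rho$) matching the left-hand side in $t$ and satisfying $C_0$. If $q\to_s q'$ or $q\to_c q'$, then $\mathrm{rewc}(p:q,\ldots)\mathbin{@} s\to_c\mathrm{rewc}(p:q',\ldots)\mathbin{@} s$. For each $\sigma'$ extending $\sigma$ with $\sigma'(p)=t'$ and satisfying the equational condition $C_0$: $\mathrm{rewc}(p:t'\mathbin{@}\varepsilon,\sigma,C_0\wedge l\Rightarrow p'\wedge C,\alpha\vec\alpha,\theta,r,c;t)\mathbin{@} s\to_c\mathrm{rewc}(p':\sigma'(l)\mathbin{@}\alpha\theta,\sigma',C,\vec\alpha,\theta,r,c;t)\mathbin{@} s$, and, when no rewriting fragment remains, $\mathrm{rewc}(p:t'\mathbin{@}\varepsilon,\sigma,C_0,\ldots,r,c;t)\mathbin{@} s\to_s c(\sigma'(r))\mathbin{@} s$. - $t\mathbin{@}(\mathtt{matchrew}\,P\,\mathtt{s.t.}\,C\,\mathtt{by}\,x_1\,\mathtt{using}\,\alpha_1,\ldots)s\to_c\mathrm{subterm}(x_1:\sigma(x_1)\mathbin{@}\alpha_1\sigma,\ldots,x_n:\sigma(x_n)\mathbin{@}\alpha_n\sigma;\sigma_{-\{x_1,\ldots,x_n\}}(P))\mathbin{@}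 s$ for each match $\sigma$ of $t$ with $P$ satisfying $C$ and extending $\theta$ ($\sigma_{-X}$ leaves the variables in $X$ untouched). If $q_i\to_\bullet q_i'$ with $\bullet\in\{s,c\}$, then $\mathrm{subterm}(\ldots,x_i:q_i,\ldots;t)\mathbin{@} s\to_\bullet\mathrm{subterm}(\ldots,x_i:q_i',\ldots;t)\mathbin{@} s$. $\mathrm{subterm}(x_1:t_1\mathbin{@}\varepsilon,\ldots,x_n:t_n\mathbin{@}\varepsilon;t)\mathbin{@} s\to_c t[x_1/t_1,\ldots,x_n/t_n]\mathbin{@} s$. - $t\mathbin{@} sl(t_1,\ldots,t_n)s\to_c t\mathbin{@}\delta\sigma s$ for every definition whose left-hand side matches the call instantiated by $\theta$, with substitution $\sigma$ (and condition satisfied), $\delta$ being its right-hand side; if the top of $s$ is a substitution, it is replaced by $\sigma$ (tail call). **Denotation.** $\twoheadrightarrow$ is $\to_c^*$ followed by one $\to_s$. $\mathrm{Ex}^*(\alpha,t)=\{q_0\cdots q_n: q_0=t\mathbin{@}\alpha,\ q_k\twoheadrightarrow q_{k+1},\ q_n\to_c^* t'\mathbin{@}\varepsilon \text{ for some } t'\in T_\Sigma\}$, $\mathrm{Ex}^\omega(\alpha,t)=\{(q_k)_{k\ge0}: q_0=t\mathbin{@}\alpha,\ q_k\twoheadrightarrow q_{k+1}\}$, $E(\alpha,t)=\mathrm{cterm}(\mathrm{Ex}^*(\alpha,t)\cup\mathrm{Ex}^\omega(\alpha,t))$ (cterm applied letterwise), and $E(\alpha)=\bigcup_{t\in T_\Sigma}E(\alpha,t)$.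 *)

(* Defs.v *)
From Stdlib Require Import List Relations.
From HB Require Import structures.
From mathcomp Require Import all_boot.
From mathcomp Require Import boolp classical_sets.

Set Implicit Arguments.
Unset Strict Implicit.
Unset Printing Implicit Defensive.

Local Open Scope classical_set_scope.

(** * Words and oo-recursively enumerable languages *)

Inductive word (A : Type) : Type :=
  | Fin of seq A
  | Inf of nat -> A.

Definition wmap (A B : Type) (f : A -> B) (w : word A) : word B :=
  match w with
  | Fin s => Fin (map f s)
  | Inf s => Inf (f \o s)
  end.

Inductive move := MoveL | MoveR | Stay.

(* Nondeterministic machines with one tape, infinite to the right only.
   Moving left from position 0 leaves the head where it is. *)
Record machine (A : finType) := Machine {
  mstate : finType;
  msym : finType;
  minput : A -> msym;
  mblank : msym;
  minput_inj : injective minput;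
  minput_blank : forall a, minput a != mblank;
  mstart : mstate;
  mdelta : mstate -> msym -> mstate -> msym -> move -> bool;
  mfinal : {set mstate} }.

Section Machines.
Context (A : finType) (M : machine A).

Record config := Config {
  cstate : mstate M;
  ctape : nat -> msym M;
  cpos : nat }.

Definition shift (d : move) (p : nat) : nat :=
  match d with MoveL => p.-1 | MoveR => p.+1 | Stay => p end.

Definition mnext (c c' : config) : Prop :=
  exists (a : msym M) (d : move),
    [/\ mdelta (cstate c) (ctape c (cpos c)) (cstate c') a d,
        cpos c' = shift d (cpos c) &
        ctape c' = fun i => if i == cpos c then a else ctape c i].

Definition init_config (tape : nat -> msym M) : config :=
  Config (mstart M) tape 0.

Definition accepts_fin (s : seq A) : Prop :=
  exists c, clos_refl_trans _ mnext
              (init_config (nth (mblank M) (map (@minput _ M) s))) c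
            /\ cstate c \in mfinal M.

Definition accepts_inf (s : nat -> A) : Prop :=
  exists run : nat -> config,
    [/\ run 0 = init_config (@minput _ M \o s),
        forall n, mnext (run n) (run n.+1),
        (* the run is complete *)
        forall p, exists n, cpos (run n) = p &
        (* Buchi condition *)
        forall n, exists2 m, (n <= m)%N & cstate (run m) \in mfinal M].

End Machines.

Definition inf_re_over (A : finType) (L : set (word A)) : Prop :=
  (exists M : machine A, forall s, L (Fin s) <-> accepts_fin M s) /\
  (exists M : machine A, forall s, L (Inf s) <-> accepts_inf M s).

(* Languages over a finite alphabet of elements of U. *)
Definition inf_re (T : Type) (U : set T) (L : set (word T)) : Prop :=
  exists (A : finType) (a : A -> T) (LA : set (word A)),
    [/\ injective a, forall x, U (a x), inf_re_over LA & L = wmap a @` LA].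

(** * Terms and membership equational logic *)

Record signature := Signature {
  kinds : eqType;
  sorts : Type;
  sort_kind : sorts -> kinds;
  ops : Type;
  arity : ops -> nat;
  arg_kind : forall f : ops, 'I_(arity f) -> kinds;
  res_kind : ops -> kinds }.

(* A variable carries its kind.  A variable of sort s, in a sentence, a rule or
   a pattern, is one of the kind of s with the condition x : s. *)
Definition var (S : signature) : eqType := (kinds S * nat)%type.

Section Terms.
Context (S : signature).

(* Raw terms; the well-kinded ones are singled out by [wf]. *)
Inductive term : Type :=
  | Var of var S
  | App (f : ops S) of 'I_(arity f) -> term.

Definition tkind (t : term) : kinds S :=
  match t with Var x => x.1 | App f _ => res_kind f end.

Fixpoint wf (t : term) : Prop :=
  match t with
  | Var _ => True
  | App f ts => forall i, tkind (ts i) = arg_kind i /\ wf (ts i)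
  end.

Fixpoint ground (t : term) : Prop :=
  match t with
  | Var _ => False
  | App f ts => forall i, ground (ts i)
  end.

Fixpoint occurs (x : var S) (t : term) : Prop :=
  match t with
  | Var y => x = y
  | App f ts => exists i, occurs x (ts i)
  end.

(* The set T_Sigma *)
Definition gterm : set term := [set t | ground t /\ wf t].

(* A substitution is the identity on the variables that it does not bind. *)
Definition subst := var S -> term.

Fixpoint inst (sg : subst) (t : term) : term :=
  match t with
  | Var x => sg x
  | App f ts => App (fun i => inst sg (ts i))
  end.

Definition bound (sg : subst) : set (var S) := [set x | sg x <> Var x].

Definition gsubst (sg : subst) : Prop :=
  forall x, bound sg x -> gterm (sg x) /\ tkind (sg x) = x.1.

Definition extends (sg th : subst) : Prop :=
  forall x, bound th x -> sg x = th x.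

Fixpoint of_list (l : seq (var S * term)) : subst :=
  match l with
  | [::] => Var
  | (x, t) :: l' => fun y => if y == x then t else of_list l' y
  end.

Definition unbind (xs : seq (var S)) (sg : subst) : subst :=
  fun y => if y \in xs then Var y else sg y.

(* One-hole contexts; in [Under i ts c] the argument [ts i] is irrelevant. *)
Inductive ctx : Type :=
  | Hole
  | Under (f : ops S) of 'I_(arity f) & 'I_(arity f) -> term & ctx.

Fixpoint plug (c : ctx) (t : term) : term :=
  match c with
  | Hole => t
  | Under f i ts c' => App (fun j => if j == i then plug c' t else ts j)
  end.

Inductive atom : Type :=
  | Equ of term & term
  | Mem of term & sorts S.

Definition wf_atom (a : atom) : Prop :=
  match a with
  | Equ t u => [/\ wf t, wf u & tkind t = tkind u]
  | Mem t s => wf t /\ tkind t = sort_kind s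
  end.

Definition inst_atom (sg : subst) (a : atom) : atom :=
  match a with
  | Equ t u => Equ (inst sg t) (inst sg u)
  | Mem t s => Mem (inst sg t) s
  end.

Definition ground_atom (a : atom) : Prop :=
  match a with
  | Equ t u => ground t /\ ground u
  | Mem t _ => ground t
  end.

Definition occurs_atom (x : var S) (a : atom) : Prop :=
  match a with
  | Equ t u => occurs x t \/ occurs x u
  | Mem t _ => occurs x t
  end.

(* An equation or membership, universally quantified over the variables that
   occur in it, with a condition. *)
Record sentence := Sentence {
  concl : atom;
  hyps : seq atom }.

Definition wf_sentence (e : sentence) : Prop :=
  wf_atom (concl e) /\ Forall wf_atom (hyps e).

(* Provability of ground atoms.  Kinds may be empty, so that a sentence is
   instantiated only by substitutions that bind all of its variables. *)
Inductive entails (E : set sentence) : atom -> Prop :=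
  | ent_refl t : gterm t -> entails E (Equ t t)
  | ent_sym t u : entails E (Equ t u) -> entails E (Equ u t)
  | ent_trans t u v :
      entails E (Equ t u) -> entails E (Equ u v) -> entails E (Equ t v)
  | ent_cong f (ts us : 'I_(arity f) -> term) :
      gterm (App ts) -> (forall i, entails E (Equ (ts i) (us i))) ->
      entails E (Equ (App ts) (App us))
  | ent_mem t u s :
      entails E (Equ t u) -> entails E (Mem u s) -> entails E (Mem t s)
  | ent_mp e sg :
      E e -> gsubst sg -> ground_atom (inst_atom sg (concl e)) ->
      (forall a, In a (hyps e) -> entails E (inst_atom sg a)) ->
      entails E (inst_atom sg (concl e)).

(* Condition fragments of rules *)
Inductive frag : Type :=
  | FAtom of atom
  | FRew of term & term.

Definition wf_frag (a : frag) : Prop :=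
  match a with
  | FAtom b => wf_atom b
  | FRew l p => [/\ wf l, wf p & tkind l = tkind p]
  end.

Definition is_rew (a : frag) : bool :=
  match a with FAtom _ => false | FRew _ _ => true end.

End Terms.

Arguments Var {S}.
Arguments Hole {S}.

Record rule (S : signature) (label : Type) := Rule {
  rlabel : label;
  lhs : term S;
  rhs : term S;
  rcond : seq (frag S) }.

Definition wf_rule S label (r : rule S label) : Prop :=
  [/\ wf (lhs r), wf (rhs r), tkind (lhs r) = tkind (rhs r) &
      Forall (@wf_frag S) (rcond r)].

Record rewrite_theory := RewriteTheory {
  rsig :> signature;
  labels : Type;
  eqs : set (sentence rsig);
  rules : set (rule rsig labels);
  eqs_wf : forall e, eqs e -> wf_sentence e;
  rules_wf : forall r, rules r -> wf_rule r }.

Section Rewriting.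
Context (R : rewrite_theory).

Definition eqE (t u : term R) : Prop := entails (@eqs R) (Equ t u).

Definition sat (sg : subst R) (C : seq (atom R)) : Prop :=
  forall a, In a C -> entails (@eqs R) (inst_atom sg a).

(* [step_at c t t'] is one-step rewriting in context c, modulo E. *)
Inductive step_at : ctx R -> term R -> term R -> Prop :=
  | StepAt r sg c t t' :
      rules r -> gsubst sg ->
      (forall a, In (FAtom a) (rcond r) ->
         entails (@eqs R) (inst_atom sg a)) ->
      (forall l p, In (FRew l p) (rcond r) -> steps (inst sg l) (inst sg p)) ->
      eqE t (plug c (inst sg (lhs r))) ->
      eqE t' (plug c (inst sg (rhs r))) ->
      step_at c t t'
with steps : term R -> term R -> Prop :=
  | StepsNil t t' : eqE t t' -> steps t t'
  | StepsCons c t t' t'' : step_at c t t' -> steps t' t'' -> steps t t''.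

Definition step (t t' : term R) : Prop := exists c, step_at c t t'.

(* Elements of T_(Sigma/E), as sets of ground terms *)
Definition cls (t : term R) : set (term R) := [set u | eqE t u].

Definition TE : set (set (term R)) := cls @` gterm (S := R).

Definition step_cls (c c' : set (term R)) : Prop :=
  exists t t', [/\ gterm t, gterm t', c = cls t, c' = cls t' & step t t'].

Definition executions : set (word (set (term R))) :=
  [set w | match w with
           | Fin s =>
               [/\ s <> [::], forall c, In c s -> TE c &
                   forall s1 c c' s2, s = s1 ++ c :: c' :: s2 -> step_cls c c']
           | Inf s => forall k, step_cls (s k) (s k.+1)
           end].

End Rewriting.

(** * Strategies *)

(* Strategy names are natural numbers. *)
Inductive strat (R : rewrite_theory) : Type :=
  | Idle
  | Fail
  | Match of term R & seq (atom R)
  | Seq of strat R & strat R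
  | Alt of strat R & strat R
  | Star of strat R
  | Cond of strat R & strat R & strat R
  | Matchrew of term R & seq (atom R) & seq (var R * strat R)
  | Call of nat & seq (term R)
  | All of bool                         (* the flag stands for top(_) *)
  | Apply of bool & labels R & seq (var R * term R) & seq (strat R).

Arguments Idle {R}.
Arguments Fail {R}.
Arguments Call {R}.
Arguments All {R}.

Record stratdef (R : rewrite_theory) := Stratdef {
  sname : nat;
  sparams : seq (term R);
  scond : seq (atom R);
  sbody : strat R }.

Section Semantics.
Context (R : rewrite_theory) (D : seq (stratdef R)).

Fixpoint wf_strat (al : strat R) : Prop :=
  match al with
  | Idle | Fail | All _ => True
  | Match P C => wf P /\ Forall (@wf_atom R) C
  | Seq a b | Alt a b => wf_strat a /\ wf_strat b
  | Star a => wf_strat a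
  | Cond a b c => [/\ wf_strat a, wf_strat b & wf_strat c]
  | Matchrew P C subs =>
      [/\ wf P, Forall (@wf_atom R) C, (0 < size subs)%N,
          uniq (map fst subs) /\
          Forall (fun xa : var R * strat R => occurs xa.1 P) subs &
          foldr (fun (xa : var R * strat R) acc => wf_strat xa.2 /\ acc)
            True subs]
  | Call _ args => Forall (@wf R) args
  | Apply _ _ rho als =>
      [/\ uniq (map fst rho),
          Forall (fun xt : var R * term R => wf xt.2 /\ tkind xt.2 = xt.1.1)
            rho &
          foldr (fun a acc => wf_strat a /\ acc) True als]
  end.

Definition wf_stratdef (d : stratdef R) : Prop :=
  [/\ Forall (@wf R) (sparams d), Forall (@wf_atom R) (scond d) &
      wf_strat (sbody d)].

Inductive sitem : Type :=
  | SStrat of strat R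
  | SSubst of subst R.

Definition stack := seq sitem.

Fixpoint vctx (s : stack) : subst R :=
  match s with
  | [::] => Var
  | SSubst th :: _ => th
  | SStrat _ :: s' => vctx s'
  end.

Inductive xstate : Type :=
  | XTerm of term R & stack
  | XSub of seq (var R * xstate) & term R & stack
  | XRewc (p : term R) (q : xstate) (sg : subst R) (C : seq (frag R))
      (als : seq (strat R)) (th : subst R) (r : term R) (c : ctx R)
      (t : term R) (s : stack).

Fixpoint cterm (q : xstate) : term R :=
  match q with
  | XTerm t _ => t
  | XSub qs t _ =>
      inst (of_list (map (fun xq => let: (x, q') := xq in (x, cterm q')) qs)) t
  | XRewc _ _ _ _ _ _ _ _ t _ => t
  end.

(* Matching substitutions for a pattern with a condition, extending th, bind
   no other variables: a free variable of a strategy must not be captured. *)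
Definition bounded (sg th : subst R) (Ps : seq (term R)) (C : seq (atom R)) :=
  forall x, bound sg x ->
    [\/ bound th x, exists2 P, In P Ps & occurs x P |
        exists2 a, In a C & occurs_atom x a].

Definition matches (th : subst R) (t P : term R) (C : seq (atom R))
    (sg : subst R) : Prop :=
  [/\ gsubst sg, extends sg th, bounded sg th [:: P] C, eqE t (inst sg P) &
      sat sg C].

(* sg binds the variables in the initial substitution rho as it says, its
   terms being instantiated by th. *)
Definition initially (rho : seq (var R * term R)) (th sg : subst R) : Prop :=
  forall x t, In (x, t) rho -> sg x = inst th t.

(* A tail call replaces the substitution on the top of the stack. *)
Definition pop_subst (s : stack) : stack :=
  match s with SSubst _ :: s' => s' | _ => s end.

Inductive tlabel := Sys | Ctl.

(* The transition relations ->_s and ->_c, given the set N of states from which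
   ->_(s,c) is considered to terminate without reaching a solution. *)
Inductive trans (N : set xstate) : tlabel -> xstate -> xstate -> Prop :=
  | TIdle t s : trans N Ctl (XTerm t (SStrat Idle :: s)) (XTerm t s)
  | TPop t th s : trans N Ctl (XTerm t (SSubst th :: s)) (XTerm t s)
  | TMatch t P C s sg :
      matches (vctx s) t P C sg ->
      trans N Ctl (XTerm t (SStrat (Match P C) :: s)) (XTerm t s)
  | TSeq t a b s :
      trans N Ctl (XTerm t (SStrat (Seq a b) :: s))
                  (XTerm t (SStrat a :: SStrat b :: s))
  | TAltL t a b s :
      trans N Ctl (XTerm t (SStrat (Alt a b) :: s)) (XTerm t (SStrat a :: s))
  | TAltR t a b s :
      trans N Ctl (XTerm t (SStrat (Alt a b) :: s)) (XTerm t (SStrat b :: s))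
  | TStarEnd t a s :
      trans N Ctl (XTerm t (SStrat (Star a) :: s)) (XTerm t s)
  | TStarIter t a s :
      trans N Ctl (XTerm t (SStrat (Star a) :: s))
                  (XTerm t (SStrat a :: SStrat (Star a) :: s))
  | TCondThen t a b c s :
      trans N Ctl (XTerm t (SStrat (Cond a b c) :: s))
                  (XTerm t (SStrat a :: SStrat b :: s))
  | TCondElse t a b c s :
      N (XTerm t [:: SStrat a; SSubst (vctx s)]) ->
      trans N Ctl (XTerm t (SStrat (Cond a b c) :: s)) (XTerm t (SStrat c :: s))
  | TAll (top : bool) c t t' s :
      (top -> c = Hole) -> step_at c t t' ->
      trans N Sys (XTerm t (SStrat (All top) :: s)) (XTerm t' s)
  | TApply (top : bool) r rho c sg C0 t t' s :
      rules r -> rcond r = map (@FAtom R) C0 ->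
      (top -> c = Hole) -> gsubst sg -> initially rho (vctx s) sg ->
      eqE t (plug c (inst sg (lhs r))) -> sat sg C0 ->
      eqE t' (plug c (inst sg (rhs r))) ->
      trans N Sys (XTerm t (SStrat (Apply top (rlabel r) rho [::]) :: s))
                  (XTerm t' s)
  | TApplyRewc (top : bool) r rho c sg C0 l p C a als t s :
      rules r -> rcond r = map (@FAtom R) C0 ++ FRew l p :: C ->
      count (@is_rew R) (rcond r) = size (a :: als) ->
      (top -> c = Hole) -> gsubst sg -> initially rho (vctx s) sg ->
      eqE t (plug c (inst sg (lhs r))) -> sat sg C0 -> gterm (inst sg l) ->
      trans N Ctl
        (XTerm t (SStrat (Apply top (rlabel r) rho (a :: als)) :: s))
        (XRewc p (XTerm (inst sg l) [:: SStrat a; SSubst (vctx s)])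
           sg C als (vctx s) (rhs r) c t s)
  | TRewcIn b p q q' sg C als th r c t s :
      trans N b q q' ->
      trans N Ctl (XRewc p q sg C als th r c t s)
                  (XRewc p q' sg C als th r c t s)
  | TRewcNext p t' sg sg' C0 l p' C a als th r c t s :
      gsubst sg' -> extends sg' sg -> eqE t' (inst sg' p) -> sat sg' C0 ->
      gterm (inst sg' l) ->
      trans N Ctl
        (XRewc p (XTerm t' [::]) sg (map (@FAtom R) C0 ++ FRew l p' :: C)
           (a :: als) th r c t s)
        (XRewc p' (XTerm (inst sg' l) [:: SStrat a; SSubst th])
           sg' C als th r c t s)
  | TRewcEnd p t' sg sg' C0 th r c t s :
      gsubst sg' -> extends sg' sg -> eqE t' (inst sg' p) -> sat sg' C0 ->
      gterm (plug c (inst sg' r)) ->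
      trans N Sys
        (XRewc p (XTerm t' [::]) sg (map (@FAtom R) C0) [::] th r c t s)
        (XTerm (plug c (inst sg' r)) s)
  | TMatchrew P C subs t s sg :
      matches (vctx s) t P C sg ->
      trans N Ctl
        (XTerm t (SStrat (Matchrew P C subs) :: s))
        (XSub (map (fun xa : var R * strat R =>
                 (xa.1, XTerm (sg xa.1) [:: SStrat xa.2; SSubst sg])) subs)
           (inst (unbind (map fst subs) sg) P) s)
  | TSubIn b qs1 x q q' qs2 t s :
      trans N b q q' ->
      trans N b (XSub (qs1 ++ (x, q) :: qs2) t s)
                (XSub (qs1 ++ (x, q') :: qs2) t s)
  | TSubEnd (xts : seq (var R * term R)) t s :
      trans N Ctl
        (XSub (map (fun xt : var R * term R => (xt.1, XTerm xt.2 [::])) xts) t s)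
        (XTerm (inst (of_list xts) t) s)
  | TCall d args sg t s :
      In d D -> gsubst sg -> bounded sg Var (sparams d) (scond d) ->
      Forall2 (fun a p => eqE (inst (vctx s) a) (inst sg p))
        args (sparams d) ->
      sat sg (scond d) ->
      trans N Ctl (XTerm t (SStrat (Call (sname d) args) :: s))
                  (XTerm t (SStrat (sbody d) :: SSubst sg :: pop_subst s)).

Definition trans_any (N : set xstate) (q q' : xstate) : Prop :=
  exists b, trans N b q q'.

(* ->_(s,c) is terminating from q and reaches no solution from it. *)
Definition failing (N : set xstate) : set xstate :=
  [set q |
     ~ (exists f : nat -> xstate,
          f 0 = q /\ forall n, trans_any N (f n) (f n.+1)) /\
     ~ (exists t, clos_refl_trans _ (trans_any N) q (XTerm t [::]))].

(* The negative premise of [TCondElse] refers to the relation being defined: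
   its set of states has to satisfy [N = failing N].  As [failing] is antitone,
   it is obtained as the least fixed point of [failing \o failing]; lemma
   [failsE] proves that it is indeed a fixed point of [failing] and lemma
   [fails_unique] that there is no other. *)
Definition fails : set xstate :=
  [set q | forall N, failing (failing N) `<=` N -> N q].

Lemma trans_mono N N' b q q' :
  N `<=` N' -> trans N b q q' -> trans N' b q q'.
Proof. by move=> sN; elim=> *; econstructor; eauto. Qed.

Lemma trans_any_mono N N' q q' :
  N `<=` N' -> trans_any N q q' -> trans_any N' q q'.
Proof. by move=> sN [b h]; exists b; exact: trans_mono h. Qed.

Lemma crt_mono (T : Type) (P Q : T -> T -> Prop) x y :
  (forall a b, P a b -> Q a b) ->
  clos_refl_trans T P x y -> clos_refl_trans T Q x y.
Proof.
move=> PQ; elim=> [a b /PQ|a|a b c _ h1 _ h2]; first exact: rt_step.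
  exact: rt_refl.
exact: rt_trans h1 h2.
Qed.

Lemma failing_anti N N' : N `<=` N' -> failing N' `<=` failing N.
Proof.
move=> sN q [h1 h2]; split.
  move=> [f [f0 fS]]; apply: h1; exists f; split=> // n.
  exact: trans_any_mono (fS n).
move=> [t h]; apply: h2; exists t; apply: crt_mono h => a b.
exact: trans_any_mono.
Qed.

Lemma fails_fix2 : failing (failing fails) = fails.
Proof.
have sub : failing (failing fails) `<=` fails.
  move=> q h N hN; apply: (hN); move: q h.
  by apply: failing_anti; apply: failing_anti => q; apply.
apply/seteqP; split=> // q; apply.
by apply: failing_anti; exact: failing_anti.
Qed.

Lemma fails_sub : fails `<=` failing fails.
Proof. by move=> q; apply; rewrite fails_fix2. Qed.

(* [r] runs inside [q]: in a component of it, or with a substitution at the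
   bottom of the stack instead of a stack that yields the same context. *)
Definition slift (u v : stack) : Prop :=
  u = v \/ exists w th s',
    [/\ u = w ++ [:: SSubst th], v = w ++ s' & vctx s' = th].

Definition with_stack (q : xstate) (v : stack) : xstate :=
  match q with
  | XTerm t _ => XTerm t v
  | XSub qs t _ => XSub qs t v
  | XRewc p q sg C als th r c t _ => XRewc p q sg C als th r c t v
  end.

Definition stack_of (q : xstate) : stack :=
  match q with
  | XTerm _ s => s
  | XSub _ _ s => s
  | XRewc _ _ _ _ _ _ _ _ _ s => s
  end.

Inductive inside : xstate -> xstate -> Prop :=
  | InTop r v : slift (stack_of r) v -> inside r (with_stack r v)
  | InSub r q qs1 x qs2 t s :
      inside r q -> inside r (XSub (qs1 ++ (x, q) :: qs2) t s)
  | InRewc r p q sg C als th rh c t s :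
      inside r q -> inside r (XRewc p q sg C als th rh c t s).

Lemma inside_refl q : inside q q.
Proof.
have {2}-> : q = with_stack q (stack_of q) by case: q.
by apply: InTop; left.
Qed.

Lemma slift_strat a s v : slift (SStrat a :: s) v ->
  exists2 s2, v = SStrat a :: s2 & slift s s2.
Proof.
case=> [<-|[[|h w] [th [s' [//= [<- ->] -> e]]]]]; first by exists s => //; left.
by exists (w ++ s') => //; right; exists w, th, s'.
Qed.

Lemma slift_subst th s v : slift (SSubst th :: s) v ->
  s = [::] \/ exists2 s2, v = SSubst th :: s2 & slift s s2.
Proof.
case=> [<-|[[|h w] [th' [s' [/= [<- ->] -> e]]]]].
- by right; exists s => //; left.
- by left.
- by right; exists (w ++ s') => //; right; exists w, th', s'.
Qed.

Lemma slift_cons h u v : slift u v -> slift (h :: u) (h :: v).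
Proof.
case=> [->|[w [th [s' [-> -> e]]]]]; first by left.
by right; exists (h :: w), th, s'.
Qed.

Lemma slift_vctx u v : slift u v -> vctx u = vctx v.
Proof.
case=> [->//|[w [th [s' [-> -> e]]]]].
by elim: w => [|[a|a] w IH] //=.
Qed.

Lemma slift_pop sg u v : slift u v ->
  slift (SSubst sg :: pop_subst u) (SSubst sg :: pop_subst v).
Proof.
case=> [->|[w [th [s' [-> -> e]]]]]; first by left.
case: w => [|[a|a] w] /=.
- by right; exists [::], sg, (SSubst sg :: pop_subst s').
- by right; exists (SSubst sg :: SStrat a :: w), th, s'.
- by right; exists (SSubst sg :: w), th, s'.
Qed.

Lemma inside_trans N b r r' q : inside r q -> trans N b r r' ->
  (exists2 q', trans_any N q q' & inside r' q') \/ exists t, r' = XTerm t [::].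
Proof.
move=> rq; elim: rq r' b => {r q}
    [r v lift|r q qs1 x qs2 t s _ IH|r p q sg C als th rh c t s _ IH] r' b h;
  last first.
- case: (IH _ _ h) => [[q' [b' qq'] r'q']|?]; last by right.
  left; eexists; first by exists Ctl; exact: TRewcIn qq'.
  exact: InRewc.
- case: (IH _ _ h) => [[q' [b' qq'] r'q']|?]; last by right.
  left; eexists; first by exists b'; exact: TSubIn qq'.
  exact: InSub.
have top u t v' : slift u v' -> inside (XTerm t u) (XTerm t v').
  by move=> l; exact: (@InTop (XTerm t u)).
case: h lift => {r r' b}.
- move=> t s /slift_strat[s2 -> /top l]; left; exists (XTerm t s2) => //.
  by exists Ctl; exact: TIdle.
- move=> t th s /slift_subst[->|[s2 -> /top l]]; first by right; exists t.
  by left; exists (XTerm t s2) => //; exists Ctl; exact: TPop.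
- move=> t P C s sg m /slift_strat[s2 -> l]; left.
  exists (XTerm t s2); last exact: top.
  by exists Ctl; apply: (@TMatch _ t P C s2 sg); rewrite -(slift_vctx l).
- move=> t a b s /slift_strat[s2 -> l]; left.
  exists (XTerm t (SStrat a :: SStrat b :: s2)); first by exists Ctl; exact: TSeq.
  by apply/top/slift_cons/slift_cons.
- move=> t a b s /slift_strat[s2 -> l]; left.
  exists (XTerm t (SStrat a :: s2)); first by exists Ctl; exact: TAltL.
  exact/top/slift_cons.
- move=> t a b s /slift_strat[s2 -> l]; left.
  exists (XTerm t (SStrat b :: s2)); first by exists Ctl; exact: TAltR.
  exact/top/slift_cons.
- move=> t a s /slift_strat[s2 -> l]; left.
  exists (XTerm t s2); first by exists Ctl; exact: TStarEnd.
  exact: top.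
- move=> t a s /slift_strat[s2 -> l]; left.
  exists (XTerm t (SStrat a :: SStrat (Star a) :: s2)).
    by exists Ctl; exact: TStarIter.
  by apply/top/slift_cons/slift_cons.
- move=> t a b c s /slift_strat[s2 -> l]; left.
  exists (XTerm t (SStrat a :: SStrat b :: s2)).
    by exists Ctl; exact: TCondThen.
  by apply/top/slift_cons/slift_cons.
- move=> t a b c s n /slift_strat[s2 -> l]; left.
  exists (XTerm t (SStrat c :: s2)); last exact/top/slift_cons.
  by exists Ctl; apply: TCondElse; rewrite -(slift_vctx l).
- move=> tp c t t' s ct st /slift_strat[s2 -> l]; left.
  exists (XTerm t' s2); last exact: top.
  by exists Sys; exact: TAll st.
- move=> tp r rho c sg C0 t t' s Rr rE ct gs ini tE sC t'E.
  move=> /slift_strat[s2 -> l]; left.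
  exists (XTerm t' s2); last exact: top.
  exists Sys; apply: (@TApply _ tp r rho c sg C0 t t' s2) => //.
  by rewrite -(slift_vctx l).
- move=> tp r rho c sg C0 lh p C a als t s Rr rE cnt ct gs ini tE sC gl.
  move=> /slift_strat[s2 -> l]; left.
  exists (XRewc p (XTerm (inst sg lh) [:: SStrat a; SSubst (vctx s)])
           sg C als (vctx s) (rhs r) c t s2).
    rewrite (slift_vctx l); exists Ctl.
    apply: (@TApplyRewc _ tp r rho c sg C0 lh p C a als t s2) => //.
    by rewrite -(slift_vctx l).
  exact: (@InTop (XRewc _ _ _ _ _ _ _ _ _ _)).
- move=> b p q q' sg C als th r c t s qq' l; left.
  exists (XRewc p q' sg C als th r c t v).
    by exists Ctl; exact: TRewcIn qq'.
  exact: (@InTop (XRewc _ _ _ _ _ _ _ _ _ _)).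
- move=> p t' sg sg' C0 lh p' C a als th r c t s gs ex pE sC gl l; left.
  exists (XRewc p' (XTerm (inst sg' lh) [:: SStrat a; SSubst th])
           sg' C als th r c t v).
    by exists Ctl; exact: TRewcNext.
  exact: (@InTop (XRewc _ _ _ _ _ _ _ _ _ _)).
- move=> p t' sg sg' C0 th r c t s gs ex pE sC gr l; left.
  exists (XTerm (plug c (inst sg' r)) v); last exact: top.
  by exists Sys; exact: TRewcEnd pE sC gr.
- move=> P C subs t s sg m /slift_strat[s2 -> l]; left; eexists.
    by exists Ctl; apply: TMatchrew; rewrite -(slift_vctx l); exact: m.
  exact: (@InTop (XSub _ _ _)).
- move=> b qs1 x q q' qs2 t s qq' l; left.
  exists (XSub (qs1 ++ (x, q') :: qs2) t v).
    by exists b; exact: TSubIn.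
  exact: (@InTop (XSub _ _ _)).
- move=> xts t s l; left.
  exists (XTerm (inst (of_list xts) t) v); last exact: top.
  by exists Ctl; exact: TSubEnd.
- move=> d args sg t s Dd gs bd mE sC /slift_strat[s2 -> l]; left.
  exists (XTerm t (SStrat (sbody d) :: SSubst sg :: pop_subst s2)).
    by exists Ctl; apply: TCall => //; rewrite -(slift_vctx l).
  by apply/top/slift_cons/slift_pop.
Qed.

Lemma inside_cond t a b s q : inside (XTerm t (SStrat a :: SStrat b :: s)) q ->
  inside (XTerm t [:: SStrat a; SSubst (vctx s)]) q.
Proof.
move E : (XTerm _ _) => r rq; elim: rq E => {r q}
  [r v lift|r q qs1 x qs2 t' s' _ IH|r p q sg C als th rh c t' s' _ IH] E.
- case: r / E lift => /slift_strat[v1 -> /slift_strat[v2 -> l]] /=.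
  apply: (@InTop (XTerm t _)) => /=; right.
  exists [:: SStrat a], (vctx s), (SStrat b :: v2); split=> //=.
  by rewrite (slift_vctx l).
- by apply: InSub; exact: IH.
- by apply: InRewc; exact: IH.
Qed.

Lemma inside_sub qs1 x q' qs2 t s q :
  inside (XSub (qs1 ++ (x, q') :: qs2) t s) q -> inside q' q.
Proof.
move E : (XSub _ _ _) => r rq; elim: rq E => {r q}
  [r v lift|r q qs3 y qs4 t' s' _ IH|r p q sg C als th rh c t' s' _ IH] E.
- by case: r / E lift => _ /=; apply: InSub; exact: inside_refl.
- by apply: InSub; exact: IH.
- by apply: InRewc; exact: IH.
Qed.

Lemma inside_rewc p q' sg C als th r c t s q :
  inside (XRewc p q' sg C als th r c t s) q -> inside q' q.
Proof.
move E : (XRewc _ _ _ _ _ _ _ _ _ _) => r' rq; elim: rq E => {r' q}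
  [r' v lift|r' q qs3 y qs4 t' s' _ IH|r' p' q sg' C' als' th' rh c' t' s' _ IH]
  E.
- by case: r' / E lift => _ /=; apply: InRewc; exact: inside_refl.
- by apply: InSub; exact: IH.
- by apply: InRewc; exact: IH.
Qed.

Lemma terminating_Acc (T : Type) (P : T -> T -> Prop) x :
  ~ (exists f : nat -> T, f 0 = x /\ forall n, P (f n) (f n.+1)) ->
  Acc (fun b a => P a b) x.
Proof.
move=> nf; apply: contrapT => nx; apply: nf.
have next (y : {y | ~ Acc (fun b a => P a b) y}) :
    exists z : {y | ~ Acc (fun b a => P a b) y}, P (sval y) (sval z).
  case: y => y ny; apply: contrapT => h; apply: (ny); constructor=> z yz.
  by apply: contrapT => nz; apply: h; exists (exist _ z nz).
have [g gP] := choice next.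
exists (fun n => sval (iter n g (exist _ x nx))); split=> [//|n]; exact: gP.
Qed.

(* Below q, enlarging the oracle from fails to failing fails adds nothing. *)
Let agree (q : xstate) : Prop :=
  forall q2, clos_refl_trans _ (trans_any fails) q q2 ->
  forall r, inside r q2 ->
  forall b r', trans (failing fails) b r r' -> trans fails b r r'.

Lemma stuck_eps N b t q : ~ trans N b (XTerm t [::]) q.
Proof. by move E : (XTerm _ _) => q0 h; case: h E. Qed.

Lemma inside_reach q1 r0 r2 : inside r0 q1 ->
  clos_refl_trans _ (trans_any fails) r0 r2 ->
  (exists2 q2, clos_refl_trans _ (trans_any fails) q1 q2 & inside r2 q2) \/
  exists t, r2 = XTerm t [::].
Proof.
move=> r0q1 h; have h1 := clos_rt_rtn1 _ _ _ _ h; elim: h1 => [|y z [b yz] _ [[q2 q1q2 yq2]|[t yt]]].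
- by left; exists q1 => //; exact: rt_refl.
- case: (inside_trans yq2 yz) => [[q3 q23 zq3]|]; last by right.
  by left; exists q3 => //; apply: rt_trans q1q2 _; exact: rt_step.
- by rewrite yt in yz; case: (stuck_eps yz).
Qed.

Lemma agree_fails q1 r0 : agree q1 -> inside r0 q1 ->
  failing fails r0 -> fails r0.
Proof.
move=> ag r0q1 [nf nsol]; rewrite -fails_fix2.
have step r2 r3 : clos_refl_trans _ (trans_any fails) r0 r2 ->
    trans_any (failing fails) r2 r3 -> trans_any fails r2 r3.
  move=> /(inside_reach r0q1)[[q2 q12 rq2]|[t ->]] [b h].
    by exists b; exact: ag q12 _ rq2 _ _ h.
  by case: (stuck_eps h).
split.
  move=> [f [f0 fS]]; apply: nf; exists f; split=> // n.
  apply: (step (f n) (f n.+1)) => [|//].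
  elim: n => [|n IH]; first by rewrite f0; exact: rt_refl.
  by apply: rt_trans (IH) _; apply: rt_step; exact: step _ _ IH (fS n).
move=> [t h]; apply: nsol; exists t.
have h1 := clos_rt_rtn1 _ _ _ _ h; elim: h1 => [|y z yz _ IH]; first exact: rt_refl.
by apply: rt_trans (IH) _; apply: rt_step; exact: step _ _ IH yz.
Qed.

Lemma Acc_agree q : Acc (fun b a => trans_any fails a b) q -> agree q.
Proof.
elim=> {}q _ IH q2 h; have h1 := clos_rt_rt1n _ _ _ _ h.
case: h1 {h} => [|q1 {}q2 qq1 h1]; last first.
  exact: IH qq1 _ (clos_rt1n_rt _ _ _ _ h1).
move=> r rq b r' h; elim: h rq => {b r r'}; try by move=> *; econstructor; eauto.
- move=> t a b c s nr rq; apply: TCondElse.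
  have h := TCondThen fails t a b c s.
  case: (inside_trans rq h) => [[q1 qq1 r1q1]|[? //]].
  exact: agree_fails (IH _ qq1) (inside_cond r1q1) nr.
- move=> b p q1 q1' sg C als th r c t s _ IH1 rq; apply: TRewcIn.
  by apply: IH1; exact: inside_rewc rq.
- move=> b qs1 x q1 q1' qs2 t s _ IH1 rq; apply: TSubIn.
  by apply: IH1; exact: inside_sub rq.
Qed.

Lemma failsE : fails = failing fails.
Proof.
apply/seteqP; split; first exact: fails_sub.
move=> q nq; have [nf _] := nq.
exact: agree_fails (Acc_agree (terminating_Acc nf)) (inside_refl q) nq.
Qed.

Lemma fails_unique N : N = failing N -> N = fails.
Proof.
move=> NE; have sub : fails `<=` N by move=> q; apply; rewrite -!NE.
apply/seteqP; split=> //; rewrite failsE NE; exact: failing_anti.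
Qed.

(** * Denotation *)

Definition ctl : xstate -> xstate -> Prop := trans fails Ctl.
Definition sys : xstate -> xstate -> Prop := trans fails Sys.

Definition bigstep (q q' : xstate) : Prop :=
  exists2 q1, clos_refl_trans _ ctl q q1 & sys q1 q'.

Definition start (al : strat R) (t : term R) : xstate :=
  XTerm t [:: SStrat al].

Definition Ex_star (al : strat R) (t : term R) : set (word xstate) :=
  [set w | exists (n : nat) (q : nat -> xstate),
     [/\ w = Fin (mkseq q n.+1), q 0 = start al t,
         forall k, (k < n)%N -> bigstep (q k) (q k.+1) &
         exists t', gterm t' /\ clos_refl_trans _ ctl (q n) (XTerm t' [::])]].

Definition Ex_omega (al : strat R) (t : term R) : set (word xstate) :=
  [set w | exists q : nat -> xstate,
     [/\ w = Inf q, q 0 = start al t &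
         forall k, bigstep (q k) (q k.+1)]].

Definition Elang_from (al : strat R) (t : term R) : set (word (set (term R))) :=
  wmap (fun q => cls (cterm q)) @` (Ex_star al t `|` Ex_omega al t).

End Semantics.

(** * Extensions by auxiliary data types *)

(* Finitely many kinds, sorts and operators are added. *)
Record sig_ext (S : signature) := SigExt {
  new_kinds : finType;
  new_sorts : finType;
  new_sort_kind : new_sorts -> kinds S + new_kinds;
  new_ops : finType;
  new_arity : new_ops -> nat;
  new_arg_kind : forall f, 'I_(new_arity f) -> kinds S + new_kinds;
  new_res_kind : new_ops -> kinds S + new_kinds }.

Section SigExtension.
Context (S : signature) (X : sig_ext S).

Definition ext_sort_kind (s : sorts S + new_sorts X) :
    (kinds S + new_kinds X)%type :=
  match s with inl s => inl (sort_kind s) | inr s => new_sort_kind s end.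

Definition ext_arity (f : ops S + new_ops X) : nat :=
  match f with inl f => arity f | inr f => new_arity f end.

Definition ext_arg_kind (f : ops S + new_ops X) :
    'I_(ext_arity f) -> (kinds S + new_kinds X)%type :=
  match f with
  | inl f => fun i => inl (arg_kind i)
  | inr f => fun i => new_arg_kind i
  end.

Definition ext_res_kind (f : ops S + new_ops X) :
    (kinds S + new_kinds X)%type :=
  match f with inl f => inl (res_kind f) | inr f => new_res_kind f end.

Definition ext_sig : signature :=
  @Signature (kinds S + new_kinds X)%type (sorts S + new_sorts X)%type
    ext_sort_kind (ops S + new_ops X)%type ext_arity ext_arg_kind ext_res_kind.

Fixpoint emb (t : term S) : term ext_sig :=
  match t with
  | Var x => @Var ext_sig (inl x.1, x.2)
  | App f ts => @App ext_sig (inl f) (fun i => emb (ts i))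
  end.

Definition emb_atom (a : atom S) : atom ext_sig :=
  match a with
  | Equ t u => Equ (emb t) (emb u)
  | Mem t s => @Mem ext_sig (emb t) (inl s)
  end.

Definition emb_sentence (e : sentence S) : sentence ext_sig :=
  Sentence (emb_atom (concl e)) (map emb_atom (hyps e)).

Definition emb_frag (a : frag S) : frag ext_sig :=
  match a with
  | FAtom b => FAtom (emb_atom b)
  | FRew l p => FRew (emb l) (emb p)
  end.

Definition emb_rule label (r : rule S label) : rule ext_sig label :=
  Rule (rlabel r) (emb (lhs r)) (emb (rhs r)) (map emb_frag (rcond r)).

Lemma tkind_emb t : tkind (emb t) = inl (tkind t).
Proof. by case: t. Qed.

Lemma wf_emb t : wf t -> wf (emb t).
Proof.
elim: t => [x|f ts IH] //= wft i; have [ki wi] := wft i.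
by split; [rewrite tkind_emb ki | exact: IH].
Qed.

Lemma wf_emb_atom a : wf_atom a -> wf_atom (emb_atom a).
Proof.
case: a => [t u [wt wu e]|t s [wt e]] /=.
  by split; rewrite ?tkind_emb ?e //; exact: wf_emb.
by split; rewrite ?tkind_emb ?e //; exact: wf_emb.
Qed.

Lemma wf_emb_sentence e : wf_sentence e -> wf_sentence (emb_sentence e).
Proof.
case=> we wh; split; first exact: wf_emb_atom.
by apply/Forall_map; apply: Forall_impl wh; exact: wf_emb_atom.
Qed.

Lemma wf_emb_rule label (r : rule S label) : wf_rule r -> wf_rule (emb_rule r).
Proof.
case=> wl wr e wc; split; rewrite /= ?tkind_emb ?e //; try exact: wf_emb.
apply/Forall_map; apply: Forall_impl wc => -[b|l p] /=.
  exact: wf_emb_atom.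
by case=> ? ? h; split; rewrite ?tkind_emb ?h //; exact: wf_emb.
Qed.

End SigExtension.

(* Finitely many equations and memberships are added, and no rules. *)
Record extension (R : rewrite_theory) := Extension {
  xsig :> sig_ext R;
  new_eqs : seq (sentence (ext_sig xsig));
  new_eqs_wf : Forall (@wf_sentence (ext_sig xsig)) new_eqs }.

Section Extension.
Context (R : rewrite_theory) (X : extension R).

Definition ext_eqs : set (sentence (ext_sig X)) :=
  (@emb_sentence _ X @` @eqs R) `|` [set e | In e (new_eqs X)].

Definition ext_rules : set (rule (ext_sig X) (labels R)) :=
  @emb_rule _ X _ @` @rules R.

Lemma ext_eqs_wf e : ext_eqs e -> wf_sentence e.
Proof.
case=> [[e' He' <-]|He]; first by apply: wf_emb_sentence; exact: eqs_wf.
by move: (new_eqs_wf X) => /Forall_forall; apply.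
Qed.

Lemma ext_rules_wf r : ext_rules r -> wf_rule r.
Proof. by case=> r' Hr' <-; apply: wf_emb_rule; exact: rules_wf. Qed.

Definition ext_theory : rewrite_theory :=
  RewriteTheory ext_eqs_wf ext_rules_wf.

Definition embT (t : term R) : term ext_theory := emb X t.

(* The reduct of the initial algebra of the extension is that of R: neither
   confusion nor junk, on all the kinds of R.  Rewriting must not change
   either: it might, as new operators can have arguments of the old kinds. *)
Definition protecting : Prop :=
  [/\ forall t u, gterm t -> gterm u -> eqE (embT t) (embT u) <-> eqE t u,
      forall t s, gterm t ->
        entails (@eqs ext_theory) (Mem (embT t) (inl s : sorts ext_theory)) <->
        entails (@eqs R) (Mem t s),
      forall (u : term ext_theory) (k : kinds R),
        gterm u -> tkind u = inl k -> exists2 t, gterm t & eqE u (embT t) &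
      forall t u, gterm t -> gterm u -> step (embT t) (embT u) <-> step t u].

(* The canonical map from classes modulo E to classes in the extension *)
Definition emb_cls (c : set (term R)) : set (term ext_theory) :=
  [set u | exists2 t, c t & eqE (embT t) u].

(* E(al): the initial terms are those in T_Sigma for the signature of R. *)
Definition Elang (D : seq (stratdef ext_theory)) (al : strat ext_theory) :
    set (word (set (term ext_theory))) :=
  [set w | exists2 t, gterm t & Elang_from D al (embT t) w].

End Extension.

(* Main.v *)
From Stdlib Require Import List Relations.
From mathcomp Require Import all_boot.
From mathcomp Require Import boolp classical_sets.
From mathcomp Require Import zify.
Require Import Defs.

Set Implicit Arguments.
Unset Strict Implicit.
Unset Printing Implicit Defensive.

Local Open Scope classical_set_scope.

(** Auxiliary strings over a finite alphabet, matched on a prefix by the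
    definitions of tail-recursive strategies, are the stacks of a
    nondeterministic machine, which simulates Turing machines by control steps.

    For the finite words, the strategy guesses a word, runs the machine on it,
    and executes it once it has been accepted: for every letter it matches the
    current term against a representative of the letter and then applies [all].

    For the infinite words, the strategy repeatedly guesses a nonempty block of
    letters, executes it, and then runs the machine until it has visited all
    the positions of the block and is in a final state.  An infinite execution
    has infinitely many system steps, hence infinitely many blocks, so that the
    run of the machine is complete and meets the Buchi condition.  Conversely,
    an accepting run can be cut into such blocks. *)

(** * Strings as an auxiliary data type *)

(* The obstacle is that [Ex_omega] asks for infinitely many system steps and nothing else, so a
   Buchi condition cannot be imposed in the limit. It has to become a condition met before the next
   system step: a control phase that never ends, or ends in a dead end, produces no further letter,
   and this is the only way to reject. Words are guessed because a strategy sees only the current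
   term and not its own future; a wrong guess is caught when the letters are matched one by one.
   Nondeterminism comes from several definitions of the same strategy name whose heads match the
   same call. Strings have a kind of their own, without equations and without operators between it
   and the old kinds. This keeps the extension protecting and makes matching modulo the equations
   syntactic on strings. *)
Scheme step_at_mut := Minimality for step_at Sort Prop
  with steps_mut := Minimality for steps Sort Prop.

(** * Kinds and groundness in provable atoms *)

Section Terms.
Context (S : signature).
Implicit Types (t u : term S) (sg : subst S).

Lemma inst_ground sg t : ground t -> inst sg t = t.
Proof.
elim: t => [//|f ts IH] /= gt; congr App; apply: funext => i; exact: IH.
Qed.

Lemma tkind_inst sg t : gsubst sg -> tkind (inst sg t) = tkind t.
Proof.
case: t => [x|//] gs /=; case: (pselect (sg x = Var x)) => [-> //|b].
by have [_ ->] := gs _ b.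
Qed.

Lemma wf_inst sg t : gsubst sg -> wf t -> wf (inst sg t).
Proof.
move=> gs; elim: t => [x _|f ts IH] /=.
  case: (pselect (sg x = Var x)) => [-> //|b].
  by have [[_ ?] _] := gs _ b.
move=> wt i; have [k w] := wt i; split; last exact: IH.
by rewrite tkind_inst.
Qed.

Lemma tkind_plug (c : ctx S) t u : tkind t = tkind u ->
  tkind (plug c t) = tkind (plug c u).
Proof. by case: c. Qed.

Definition gwf (a : atom S) : Prop :=
  match a with
  | Equ t u => [/\ gterm t, gterm u & tkind t = tkind u]
  | Mem t s => gterm t /\ tkind t = sort_kind s
  end.

(** Congruence asks only its left-hand side to be a ground term. By induction the arguments on the
    right have the same kinds, which makes the right-hand side well-kinded too. *)
Lemma entails_gwf (E : set (sentence S)) a :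
  (forall e, E e -> wf_sentence e) -> entails E a -> gwf a.
Proof.
move=> Ewf; elim=> {a} /=
  [t gt|t u _ [gt gu e]|t u v _ [gt gu e] _ [_ gv e']|f ts us gf _ IH
  |t u s _ [gt gu e] _ [_ e']|e sg Ee gs gc _ _].
- by split.
- by split.
- by split=> //; rewrite e.
- split=> //; split=> /= i; have [_ [gu wu] k] := IH i; first exact: gu.
  by split=> //; rewrite -k; have [_ wf] := gf; have [] := wf i.
- by split=> //; rewrite e.
- have [wc _] := Ewf _ Ee.
  case: (concl e) wc gc => [t u [wt wu k] [gt gu]|t s [wt k] gt] /=.
    by split; rewrite ?tkind_inst //; split=> //; exact: wf_inst.
  by split; rewrite ?tkind_inst //; split=> //; exact: wf_inst.
Qed.

End Terms.

Section EqE.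
Context (R : rewrite_theory).
Implicit Types t u v : term R.

Lemma eqE_gwf t u : eqE t u -> [/\ gterm t, gterm u & tkind t = tkind u].
Proof. by move/entails_gwf; apply; exact: eqs_wf. Qed.

Lemma eqE_cls t u : eqE t u -> cls t = cls u.
Proof.
move=> tu; apply/seteqP; split=> v; apply: ent_trans => //.
exact: ent_sym.
Qed.

Lemma step_eqE t t' u u' : eqE t t' -> eqE u u' -> step t u -> step t' u'.
Proof.
move=> tt' uu' [c h]; case: h tt' uu'.
move=> r sg c0 t0 t1 Rr gs sa sr e1 e2 tt' uu'; exists c0.
apply: StepAt Rr gs sa sr _ _.
  by apply: ent_trans (ent_sym tt') e1.
by apply: ent_trans (ent_sym uu') e2.
Qed.

End EqE.

Section Strings.
Context (R : rewrite_theory) (G : finType).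

(* Strings over G: [None] is the empty string and the unary operator [Some g]
   adds [g] in front. *)
Definition str_sig : sig_ext R :=
  @SigExt R unit void (fun s => match s with end) (option G)
    (fun g => if g is Some _ then 1 else 0)
    (fun _ _ => inr tt) (fun _ => inr tt).

Definition str_ext : extension R := @Extension R str_sig [::] (Forall_nil _).

Notation S := (ext_theory str_ext).
Notation emb := (embT str_ext).

Lemma gterm_emb (t : term R) : gterm t -> gterm (emb t).
Proof.
case=> g w; split; last exact: wf_emb.
by elim: t g {w} => [//|f ts IH] /= g i; exact: IH.
Qed.

Lemma tkind_embT (t : term R) : tkind (emb t) = inl (tkind t).
Proof. exact: tkind_emb. Qed.

Definition emb_subst (sg : subst R) : subst S :=
  fun x => match x.1 with inl k => emb (sg (k, x.2)) | inr _ => Var x end.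

Lemma emb_inst sg t : emb (inst sg t) = inst (emb_subst sg) (emb t).
Proof.
elim: t => [[k n]//|f ts IH].
by congr (@App S (inl f)); apply: funext => i; exact: IH.
Qed.

Lemma emb_inst_atom sg (a : atom R) :
  emb_atom str_sig (inst_atom sg a) =
  inst_atom (emb_subst sg) (emb_atom str_sig a).
Proof. by case: a => [t u|t s]; rewrite /= -!emb_inst. Qed.

Lemma emb_gsubst sg : gsubst sg -> gsubst (emb_subst sg).
Proof.
move=> gs [[k|k] n]; rewrite /bound /emb_subst /= => b; last by case: b.
have [|gt kt] := gs (k, n); first by move=> e; apply: b; rewrite e.
by split; [exact: gterm_emb | rewrite tkind_embT kt].
Qed.

Lemma emb_ground_atom (a : atom R) :
  ground_atom a -> ground_atom (emb_atom str_sig a).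
Proof.
have g (t : term R) : ground t -> ground (emb t).
  by elim: t => [//|f ts IH] /= g i; exact: IH.
by case: a => [t u [gt gu]|t s /g //]; split; exact: g.
Qed.

Lemma emb_entails (a : atom R) :
  entails (@eqs R) a -> entails (@eqs S) (emb_atom str_sig a).
Proof.
elim=> {a} /=.
- by move=> t gt; apply: ent_refl; exact: gterm_emb.
- by move=> t u _ /ent_sym.
- by move=> t u v _ h1 _ h2; exact: ent_trans h1 h2.
- move=> f ts us gf _ IH; apply: (@ent_cong S _ (inl f)) => //.
  exact: (gterm_emb gf).
- by move=> t u s _ h1 _ h2; exact: ent_mem h1 h2.
- move=> e sg Ee gs gc _ IH; rewrite emb_inst_atom.
  apply: (@ent_mp S _ (emb_sentence str_sig e)).
  + by left; exists e.
  + exact: emb_gsubst.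
  + by rewrite -emb_inst_atom; exact: emb_ground_atom.
  + move=> a /= /in_map_iff[a' [<- ia]]; rewrite -emb_inst_atom; exact: IH.
Qed.

(* Only used on the old kinds: [d] is a junk value for the strings. *)
Context (d : term R).

Fixpoint ret (t : term S) : term R :=
  match t with
  | Var x => match x.1 with inl k => Var (k, x.2) | inr _ => d end
  | App f ts =>
      let us := fun i => ret (ts i) in
      match f as f return ('I_(ext_arity f) -> term R) -> term R with
      | inl f => fun us => App us
      | inr _ => fun _ => d
      end us
  end.

Lemma embK t : ret (emb t) = t.
Proof.
elim: t => [[k n]//|f ts IH] /=; congr App; apply: funext => i; exact: IH.
Qed.

(** Operators of [R] take old kinds only and every new operator returns a string. Hence a ground
    term of an old kind is built from operators of [R] alone, and [ret] never meets the junk case in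
    it. *)
Lemma retP (t : term S) k : gterm t -> tkind t = inl k ->
  [/\ gterm (ret t), tkind (ret t) = k & emb (ret t) = t].
Proof.
elim: t k => [x|[f|f] ts IH] k [//= g w] //= [e].
have {}IH i : [/\ gterm (ret (ts i)), tkind (ret (ts i)) = @arg_kind R f i
    & emb (ret (ts i)) = ts i].
  by have [ki wi] := w i; apply: IH.
split=> //; first by split=> /= i; have [[]] := IH i.
by congr (@App S (inl f)); apply: funext => i; have [] := IH i.
Qed.

Definition ret_subst (sg : subst S) : subst R :=
  fun x => ret (sg (inl x.1, x.2)).

Lemma ret_inst sg t : ret (inst sg (emb t)) = inst (ret_subst sg) t.
Proof.
elim: t => [[k n]//|f ts IH] /=; congr App; apply: funext => i; exact: IH.
Qed.

Lemma ret_gsubst sg : gsubst sg -> gsubst (ret_subst sg).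
Proof.
move=> gs [k n]; rewrite /bound /ret_subst /= => b.
have [|gt kt] := gs (inl k, n); first by move=> e; apply: b; rewrite e.
by have [] := retP gt kt.
Qed.

(** The induction hypothesis for [ret_entails]. Equations between strings are left out because [ret]
    sends all ground strings to [d], which need not even be ground. *)
Definition ret_holds (a : atom S) : Prop :=
  match a with
  | Equ t u => forall k, tkind t = inl k -> eqE (ret t) (ret u)
  | Mem t (inl s) => entails (@eqs R) (Mem (ret t) s)
  | Mem t (inr s) => False
  end.

Lemma ret_holds_emb sg a : gsubst sg ->
  ret_holds (inst_atom sg (emb_atom str_sig a)) ->
  entails (@eqs R) (inst_atom (ret_subst sg) a).
Proof.
move=> gs; case: a => [t u|t s] /=; last by rewrite -ret_inst.
by rewrite -!ret_inst; apply; rewrite tkind_inst // tkind_emb.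
Qed.

(** Both sides of a provable equation have the same kind, so a derivation for an old kind never
    needs an equation between strings, and its instances of sentences of [R] translate back. *)
Lemma ret_entails (a : atom S) : entails (@eqs S) a -> ret_holds a.
Proof.
have gwfE a' : entails (@eqs S) a' -> gwf a'.
  by apply: entails_gwf; exact: eqs_wf.
elim=> {a}.
- by move=> t gt k kt; apply: ent_refl; have [] := retP gt kt.
- move=> t u /gwfE[_ _ e] IH k kt; apply: ent_sym; apply: (IH k).
  by rewrite e.
- move=> t u v /gwfE[_ _ e] IH1 _ IH2 k kt; apply: ent_trans (IH1 k kt) _.
  by apply: (IH2 k); rewrite -e.
- move=> [f|f] ts us gf h IH k //= kt; apply: ent_cong => [|i].
    by have [] := retP gf kt.
  by have [_ wf] := gf; have [ki _] := wf i; exact: (IH i _ ki).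
- move=> t u s /gwfE[_ _ e] IH1 hu IH2.
  case: s hu IH2 => [s|[]] /gwfE[/= _ ku] IH2.
  by apply: ent_mem IH2; apply: (IH1 (sort_kind s)); rewrite e.
- move=> e sg [[e' Ee' <-]|[]] gs gc hy IH /=.
  have hC : entails (@eqs S) (inst_atom sg (emb_atom str_sig (concl e'))).
    by apply: (@ent_mp S _ (emb_sentence str_sig e')) => //; left; exists e'.
  have gR : ground_atom (inst_atom (ret_subst sg) (concl e')).
    case: (concl e') (gwfE _ hC) => [t u|t s] /=; rewrite -!ret_inst.
      move=> [gt gu _]; split.
        by have [||[]] := @retP (inst sg (emb t)) (tkind t);
          rewrite ?tkind_inst ?tkind_emb.
      by have [||[]] := @retP (inst sg (emb u)) (tkind u);
        rewrite ?tkind_inst ?tkind_emb.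
    move=> [gt _].
    by have [||[]] := @retP (inst sg (emb t)) (tkind t);
      rewrite ?tkind_inst ?tkind_emb.
  have : entails (@eqs R) (inst_atom (ret_subst sg) (concl e')).
    apply: ent_mp => //; first exact: ret_gsubst.
    move=> a ia; apply: ret_holds_emb => //; apply: IH.
    by apply/in_map_iff; exists a.
  case: (concl e') => [t u|t s] /=; by rewrite -!ret_inst.
Qed.

Lemma ret_eqE (t u : term S) k : tkind t = inl k -> eqE t u ->
  eqE (ret t) (ret u).
Proof. by move=> kt /ret_entails/(_ _ kt). Qed.

(** [Hole] is a junk value: a context that yields a term of an old kind has no new operator on the
    path to its hole. *)
Fixpoint ret_ctx (c : ctx S) : ctx R :=
  match c with
  | Hole => Hole
  | Under f i ts c =>
      let us := fun i => ret (ts i) in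
      let c := ret_ctx c in
      match f as f return 'I_(ext_arity f) ->
          ('I_(ext_arity f) -> term R) -> ctx R with
      | inl f => fun i us => Under i us c
      | inr _ => fun _ _ => Hole
      end i us
  end.

Lemma ret_plug c (t : term S) k : gterm (plug c t) ->
  tkind (plug c t) = inl k -> ret (plug c t) = plug (ret_ctx c) (ret t).
Proof.
elim: c k => [//|[f|f] i ts c IH] k [g w] //= kt.
congr App; apply: funext => j; case: eqP => // ji.
have := w j; have /= := g j; rewrite ji eqxx => gi [ki wi].
by apply: IH ki.
Qed.

Lemma ret_step c (t u : term S) k : step_at c t u -> tkind t = inl k ->
  step_at (ret_ctx c) (ret t) (ret u).
Proof.
pose P c (t u : term S) := forall k, tkind t = inl k ->
  step_at (ret_ctx c) (ret t) (ret u).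
pose Q (t u : term S) := forall k, tkind t = inl k -> steps (ret t) (ret u).
move=> h; move: k; apply: (@step_at_mut S P Q _ _ _ c t u h) => {c t u h}
  [_ sg c t t' [r' Rr' <-] gs ha _ hr et et' k kt|t t' tt' k kt
  |c t t' t'' h IH _ IH2 k kt].
-
  have [[_ _ e1] [_ _ e2]] := (eqE_gwf et, eqE_gwf et').
  have [wl wr ee _] := rules_wf Rr'.
  have [_ gl _] := eqE_gwf et; have [_ gr _] := eqE_gwf et'.
  have kc : tkind (plug c (inst sg (emb (lhs r')))) =
            tkind (plug c (inst sg (emb (rhs r')))).
    by apply: tkind_plug; rewrite !tkind_inst // !tkind_emb ee.
  apply: (@StepAt _ r' (ret_subst sg)) => //.
  + exact: ret_gsubst.
  + move=> a ia; apply: ret_holds_emb => //; apply: ret_entails; apply: ha.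
    by apply/in_map_iff; exists (FAtom a).
  + move=> l p ilp; rewrite -!ret_inst.
    apply: (hr (emb l) (emb p) _ (tkind l)).
      by apply/in_map_iff; exists (FRew l p).
    by rewrite tkind_inst // tkind_emb.
  + rewrite -ret_inst -(ret_plug (k := k)) //; last by rewrite -e1.
    exact: ret_eqE kt et.
  + rewrite -ret_inst -(ret_plug (k := k)) //; last by rewrite -kc -e1.
    by apply: (@ret_eqE _ _ k) et'; rewrite e2 -kc -e1.
- apply: StepsNil; exact: ret_eqE kt tt'.
(* The two sides of a rule have the same kind, so the kind remains old along the sequence of
   steps. *)
- apply: StepsCons (IH k kt) _; apply: (IH2 k).
  rewrite -kt; case: h {IH IH2 kt} =>
    r sg {}c {}t {}t' [r' Rr' <-] gs _ _ et et'.
  have [_ _ ->] := eqE_gwf et; have [_ _ ->] := eqE_gwf et'.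
  have [_ _ ee _] := rules_wf Rr'.
  by apply: tkind_plug; rewrite !tkind_inst // !tkind_emb ee.
Qed.

(** Every equation of the extension comes from [R] and relates terms of an old kind. Equality of
    strings thus arises from reflexivity, symmetry, transitivity and congruence alone. *)
Lemma eqE_str (t u : term S) : eqE t u -> tkind t = inr tt -> t = u.
Proof.
pose P (a : atom S) := if a is Equ t u then tkind t = inr tt -> t = u else True.
move=> h; suff: P (Equ t u) by [].
have gwfE a' : entails (@eqs S) a' -> gwf a'.
  by apply: entails_gwf; exact: eqs_wf.
elim: h => {t u} //=.
- by move=> t u /gwfE[_ _ e] IH k; rewrite IH // e.
- move=> t u v /gwfE[_ _ e] IH1 _ IH2 k; rewrite IH1 // IH2 //.
  by rewrite -e.
- move=> [f|f] ts us gf h IH //= kt.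
  congr App; apply: funext => i; apply: IH.
  by have [_ wf] := gf; have [] := wf i.
- move=> e sg [[e' Ee' <-]|[]] gs _ _ _ /=.
  by case: (concl e') => //= t u; rewrite tkind_inst // tkind_emb.
Qed.

End Strings.

(** * The extension by strings is protecting *)

Section Protecting.
Context (R : rewrite_theory) (G : finType).
Notation S := (ext_theory (str_ext R G)).
Notation emb := (embT (str_ext R G)).

Fixpoint emb_ctx (c : ctx R) : ctx S :=
  match c with
  | Hole => Hole
  | Under f i ts c => @Under S (inl f) i (fun i => emb (ts i)) (emb_ctx c)
  end.

Lemma emb_plug c t : emb (plug c t) = plug (emb_ctx c) (emb t).
Proof.
elim: c => [//|f i ts c IH] /=; congr (@App S (inl f)); apply: funext => j.
by case: eqP => // _; exact: IH.
Qed.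

Lemma emb_step c (t u : term R) : step_at c t u ->
  step_at (emb_ctx c) (emb t) (emb u).
Proof.
pose P c t u := step_at (emb_ctx c) (emb t) (emb u).
pose Q t u := steps (emb t) (emb u).
apply: (@step_at_mut R P Q) => {c t u}
  [r sg c t t' Rr gs ha _ hr et et'|t t' tt'|c t t' t'' _ IH _ IH2].
- apply: (@StepAt S (emb_rule (str_sig R G) r) (@emb_subst R G sg)) => //.
  + by exists r.
  + exact: emb_gsubst.
  + move=> a /in_map_iff[[b|l p] [//= [<-] ib]].
    by rewrite -emb_inst_atom; apply: emb_entails; exact: ha.
  + move=> l p /in_map_iff[[b|l' p'] [//= [<- <-] ib]].
    by rewrite -!emb_inst; exact: hr.
  + by rewrite -emb_inst -emb_plug; exact: (@emb_entails _ G _ et).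
  + by rewrite -emb_inst -emb_plug; exact: (@emb_entails _ G _ et').
- apply: StepsNil; exact: (@emb_entails _ G _ tt').
- exact: StepsCons IH IH2.
Qed.

Lemma str_protecting : protecting (str_ext R G).
Proof.
split.
- move=> t u gt gu; split; last exact: (@emb_entails _ G (Equ t u)).
  by move/(@ret_eqE _ _ t _ _ _ (tkind_embT G t)); rewrite !embK.
- move=> t s gt; split; last exact: (@emb_entails _ G (Mem t s)).
  by move=> /(@ret_entails _ _ t) /=; rewrite embK.
(* [Var (k, 0)] only serves as the junk value of [ret]. *)
- move=> u k gu ku; exists (ret (Var (k, 0)) u).
    by have [] := retP (Var (k, 0)) gu ku.
  have [_ _ ->] := retP (Var (k, 0)) gu ku; exact: ent_refl.
- move=> t u gt gu; split=> -[c h]; eexists; last exact: emb_step h.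
  by have := @ret_step _ _ t _ _ _ _ h (tkind_embT G t); rewrite !embK; apply.
Qed.

Lemma emb_cls_cls (t : term R) :
  emb_cls (X := str_ext R G) (cls t) = cls (emb t).
Proof.
apply/seteqP; split=> [u [v tv vu]|u tu].
  exact: ent_trans (@emb_entails _ G _ tv) vu.
exists t => //; apply: ent_refl; have [gt _ _] := eqE_gwf tu.
by have [] := retP t gt (tkind_embT G t); rewrite embK.
Qed.

End Protecting.

(** * Strategies as multi-stack machines *)

Lemma dependent_choice (T : Type) (P : nat -> T -> Prop)
    (Q : nat -> T -> T -> Prop) (x0 : T) :
  P 0 x0 -> (forall n x, P n x -> exists2 y, Q n x y & P n.+1 y) ->
  exists f : nat -> T,
    [/\ f 0 = x0, forall n, P n (f n) & forall n, Q n (f n) (f n.+1)].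
Proof.
move=> P0 step.
have total (nx : nat * T) : exists y,
    P nx.1 nx.2 -> Q nx.1 nx.2 y /\ P nx.1.+1 y.
  case: nx => n x /=; case: (pselect (P n x)) => [/step[y Qy Py]|nP].
    by exists y.
  by exists x.
have [g gP] := choice total.
pose f := fix f n := if n is n.+1 then g (n, f n) else x0.
have fP n : P n (f n) by elim: n => [//|n /(gP (n, f n))[]].
by exists f; split=> // n; have [] := gP (n, f n) (fP n).
Qed.

Lemma In_mem (T : eqType) (x : T) s : In x s <-> x \in s.
Proof.
elim: s => [//|y s IH] /=; rewrite inE; split.
  by case=> [->|/IH ->]; rewrite ?eqxx ?orbT.
by case/orP=> [/eqP->|/IH]; [left | right].
Qed.

Lemma mkseq_cons (T : Type) (f : nat -> T) n :
  mkseq f n.+1 = f 0 :: mkseq (fun i => f i.+1) n.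
Proof. by rewrite /mkseq /= (iotaDl 1 0) -map_comp. Qed.

Lemma clos_rt_ind_left (T : Type) (Q : T -> T -> Prop) (P : T -> Prop) x y :
  clos_refl_trans _ Q x y -> P x -> (forall u v, P u -> Q u v -> P v) -> P y.
Proof. by move=> h; elim: h => [u v uv Pu|u|u v w _ IH1 _ IH2] *; eauto. Qed.

(** * Abstract machines on tuples of strings that emit letters *)

Section Programs.
Context (G A : finType).

(* A prefix and a variable for the rest of the string; without a variable, the
   rest is empty. *)
Definition pat := (seq G * option nat)%type.
(** The head of a definition, the letter that it emits, if any, and its tail call, if any. A call
    without a letter is a silent step; a letter without a call ends the execution. *)
Definition instr :=
  ((nat * seq pat) * (option A * option (nat * seq pat)))%type.
Definition conf := (nat * seq (seq G))%type.

Implicit Types (v : nat -> seq G) (p : pat) (k : conf).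

Definition peval v p : seq G := p.1 ++ oapp v [::] p.2.

Definition cst (u : seq G) : pat := (u, None).
Definition pv (u : seq G) (i : nat) : pat := (u, Some i).

Definition closed (i : instr) : bool :=
  if i.2.2 is Some c then
    all (fun p => if p.2 is Some x then
      has (fun q : pat => q.2 == Some x) i.1.2 else true) c.2
  else true.

Context (prog : seq instr).

Inductive astep : option A -> conf -> option conf -> Prop :=
  | AStep n ps a c v : (n, ps, (a, c)) \in prog ->
      astep a (n, map (peval v) ps)
        (omap (fun c : nat * seq pat => (c.1, map (peval v) c.2)) c).

Definition tau k k' := astep None k (Some k').
Definition taus := clos_refl_trans _ tau.
Definition emits a k k' := exists2 k1, taus k k1 & astep (Some a) k1 (Some k').
Definition halts a k := exists2 k1, taus k k1 & astep (Some a) k1 None.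

(** The last letter is the term on which the strategy ends: it is matched but not rewritten, whence
    [halts] instead of [emits]. Executions being nonempty, so are these words. *)
Fixpoint frun (s : seq A) k : Prop :=
  match s with
  | [::] => False
  | a :: s' => (s' = [::] /\ halts a k) \/ exists2 k', emits a k k' & frun s' k'
  end.

Definition live (s : nat -> A) (i : nat) k : Prop :=
  exists K : nat -> conf,
    K 0 = k /\ forall j, emits (s (i + j)) (K j) (K j.+1).

Lemma liveP s i k :
  live s i k <-> exists2 k', emits (s i) k k' & live s i.+1 k'.
Proof.
split=> [[K [K0 KS]]|[k' kk' [K [K0 KS]]]].
  exists (K 1); first by rewrite -K0 -{1}[i]addn0.
  by exists (fun j => K j.+1); split=> // j; rewrite addSnnS.
exists (fun j => if j is j.+1 then K j else k); split=> // -[|j].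
  by rewrite addn0 K0.
by rewrite -addSnnS.
Qed.

End Programs.

(** * Translation of the abstract machines into strategy definitions *)

Section Strategies.
Context (R : rewrite_theory) (G A : finType).
Context (prog : seq (instr G A)) (tm : A -> term R).
Hypotheses (prog_closed : all (@closed G A) prog).
Hypotheses (tm_gterm : forall a, gterm (tm a)).

Notation S := (ext_theory (str_ext R G)).
Notation emb := (embT (str_ext R G)).
Implicit Types (t : term S) (v : nat -> seq G) (k : conf G).

Definition snil : term S :=
  @App S (inr None) (fun _ => @Var S (inr tt, 0)).
Definition scons (g : G) (t : term S) : term S :=
  @App S (inr (Some g)) (fun _ => t).

Definition enc (w : seq G) : term S := foldr scons snil w.

Definition svar (i : nat) : var S := (inr tt, i).

Definition pterm (p : pat G) : term S :=
  foldr scons (oapp (fun i => Var (svar i)) snil p.2) p.1.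

Fixpoint dec (t : term S) : seq G :=
  match t with
  | Var _ => [::]
  | App f ts =>
      let us := fun i => dec (ts i) in
      match f as f return ('I_(ext_arity f) -> seq G) -> seq G with
      | inr (Some g) => fun us => g :: us ord0
      | _ => fun _ => [::]
      end us
  end.

(** Together with [dec], this inverts [scons] by applying functions to equations; injectivity of
    [App] would give equations between dependent pairs. *)
Definition tail (t : term S) : term S :=
  match t with
  | Var _ => t
  | App f ts =>
      match f as f return ('I_(ext_arity f) -> term S) -> term S with
      | inr (Some g) => fun ts => ts ord0
      | _ => fun _ => t
      end ts
  end.

Lemma encK : cancel enc dec.
Proof. by elim=> [//|g w IH] /=; rewrite IH. Qed.

Lemma enc_gterm w : gterm (enc w).
Proof.
elim: w => [|g w [IHg IHw]]; first by split=> -[].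
by split=> /= i; first exact: IHg; split=> //; case: w {IHg IHw}.
Qed.

Lemma tkind_enc w : tkind (enc w) = inr tt.
Proof. by case: w. Qed.

Lemma pterm_wf p : wf (pterm p).
Proof.
case: p => [u o]; elim: u => [|g u IH] /=.
  by case: o => [//|] /= [].
by move=> i; split=> //; case: u IH => //=; case: o.
Qed.

Lemma inst_pterm (sg : subst S) v p :
  (forall x, p.2 = Some x -> sg (svar x) = enc (v x)) ->
  inst sg (pterm p) = enc (peval v p).
Proof.
case: p => [u o] /= h; elim: u => [|g u IH] /=; last first.
  by congr (@App S (inr (Some g))); apply: funext => _; exact: IH.
case: o h => [x|] /= h; first by rewrite h // /peval.
by congr (@App S (inr None)); apply: funext => -[].
Qed.

(** The variable stands at the end of its pattern: stripping the prefix from the encoding leaves the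
    value of the variable, which is therefore an encoding. *)
Lemma inst_pterm_inv (sg : subst S) p w x : p.2 = Some x ->
  inst sg (pterm p) = enc w ->
  sg (svar x) = enc (dec (sg (svar x))).
Proof.
case: p => [u o] /= ->; elim: u w => [|g u IH] w /=.
  by move=> ->; rewrite encK.
case: w => [|g' w] /= e; last exact: (IH w (f_equal tail e)).
by have := f_equal dec e.
Qed.

Lemma occurs_pterm p x : p.2 = Some x -> occurs (svar x) (pterm p).
Proof.
case: p => [u o] /= ->; elim: u => [//|g u IH] /=.
by exists ord0.
Qed.

Definition call (c : nat * seq (pat G)) : strat S := Call c.1 (map pterm c.2).

(** A match against a ground pattern tests membership of the current term in the class of the
    letter. [All] then takes an arbitrary step, and it is the match for the next letter that
    discards the unwanted results. *)
Definition body (i : instr G A) : strat S :=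
  match i.2 with
  | (None, None) => Fail
  | (None, Some c) => call c
  | (Some a, None) => Match (emb (tm a)) [::]
  | (Some a, Some c) =>
      Defs.Seq (Match (emb (tm a)) [::]) (Defs.Seq (All false) (call c))
  end.

Definition def (i : instr G A) : stratdef S :=
  @Stratdef S i.1.1 (map pterm i.1.2) [::] (body i).

Definition defs : seq (stratdef S) := map def prog.

Lemma call_wf c : wf_strat (call c).
Proof. by apply/Forall_map/Forall_forall => p _; exact: pterm_wf. Qed.

Lemma defs_wf : Forall (@wf_stratdef S) defs.
Proof.
apply/Forall_map/Forall_forall => -[[n ps] [a c]] _; split=> //=.
  by apply/Forall_map/Forall_forall => p _; exact: pterm_wf.
rewrite /body /=.
have we b : wf (emb (tm b)) by have [] := gterm_emb G (tm_gterm b).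
case: a c => [a|] [c|] //=; last exact: call_wf.
by split=> //; split=> //; exact: call_wf.
Qed.

Notation step b := (trans defs (fails defs) b).

(** A tail call replaces the substitution below it, so at most one substitution is ever on the
    stack, and [k] is all the information that it holds. *)
Definition at_call (s : stack S) k : Prop :=
  exists args st,
    [/\ s = SStrat (Call k.1 args) :: st,
        st = [::] \/ (exists th, st = [:: SSubst th]),
        gsubst (vctx st) & map (inst (vctx st)) args = map enc k.2].

(* The stacks that control steps reach from a call, when the term is t. *)
Inductive between (t : term S) k : stack S -> Prop :=
  | BCall s : at_call s k -> between t k s
  | BFail st : between t k (SStrat Fail :: st)
  | BEmit a k' c th : gsubst th -> astep prog (Some a) k (Some k') ->
      at_call [:: SStrat (call c); SSubst th] k' ->
      between t k [:: SStrat (body (0, [::], (Some a, Some c))); SSubst th]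
  | BMatch a k' c th : gsubst th -> astep prog (Some a) k (Some k') ->
      at_call [:: SStrat (call c); SSubst th] k' ->
      between t k [:: SStrat (Match (emb (tm a)) [::]);
                      SStrat (Defs.Seq (All false) (call c)); SSubst th]
  | BSeq a k' c th : eqE t (emb (tm a)) -> astep prog (Some a) k (Some k') ->
      at_call [:: SStrat (call c); SSubst th] k' ->
      between t k [:: SStrat (Defs.Seq (All false) (call c)); SSubst th]
  | BAll a k' c th : eqE t (emb (tm a)) -> astep prog (Some a) k (Some k') ->
      at_call [:: SStrat (call c); SSubst th] k' ->
      between t k [:: SStrat (All false); SStrat (call c); SSubst th]
  | BHalt a th : gsubst th -> astep prog (Some a) k None ->
      between t k [:: SStrat (Match (emb (tm a)) [::]); SSubst th]
  | BPop a th : eqE t (emb (tm a)) -> astep prog (Some a) k None ->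
      between t k [:: SSubst th]
  | BEnd a : eqE t (emb (tm a)) -> astep prog (Some a) k None ->
      between t k [::].

Lemma matches_eqE th t a sg :
  matches th t (emb (tm a)) [::] sg -> eqE t (emb (tm a)).
Proof.
case=> _ _ _ + _; rewrite inst_ground //.
by have [] := gterm_emb G (tm_gterm a).
Qed.

Lemma eqE_matches th t a :
  gsubst th -> eqE t (emb (tm a)) -> matches th t (emb (tm a)) [::] th.
Proof.
move=> gs e; split=> // [x b|]; first by apply: Or31.
by rewrite inst_ground //; have [] := gterm_emb G (tm_gterm a).
Qed.

(** A call matches a head modulo the equations, which by [eqE_str] is syntactic matching here. *)
Lemma Forall2_map (args : seq (term S)) ps th (sg : subst S) ws :
  map (inst th) args = map enc ws ->
  Forall2 (fun a p => eqE (inst th a) (inst sg p)) args (map pterm ps) ->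
  map (inst sg) (map pterm ps) = map enc ws.
Proof.
elim: args ps ws => [|a args IH] [|p ps] [|w ws] //= e h; inversion h => //.
case: e => ea es; congr cons; last exact: IH.
have -> : inst sg (pterm p) = inst th a.
  by symmetry; apply: eqE_str => //; rewrite ea tkind_enc.
exact: ea.
Qed.

Lemma map_peval (sg : subst S) ps ws :
  map (inst sg) (map pterm ps) = map enc ws ->
  (forall p x, p \in ps -> p.2 = Some x ->
     sg (svar x) = enc (dec (sg (svar x)))) /\
  map (peval (fun x => dec (sg (svar x)))) ps = ws.
Proof.
elim: ps ws => [|p ps IH] [|w ws] //= [e /IH[h1 <-]].
have h q x : q \in p :: ps -> q.2 = Some x ->
    sg (svar x) = enc (dec (sg (svar x))).
  rewrite inE => /orP[/eqP-> px|/h1]; last exact.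
  exact: inst_pterm_inv px e.
split=> //; congr cons; rewrite -[RHS]encK -e.
rewrite (inst_pterm (v := fun x => dec (sg (svar x)))) ?encK //.
by move=> x px; apply: (h p) => //; rewrite inE eqxx.
Qed.

Lemma closed_subst (sg : subst S) v n ps a c :
  (n, ps, (a, Some c)) \in prog ->
  (forall p x, p \in ps -> p.2 = Some x -> sg (svar x) = enc (v x)) ->
  map (inst sg) (map pterm c.2) = map enc (map (peval v) c.2).
Proof.
move=> /(allP prog_closed) /= /allP cl h; rewrite -!map_comp.
apply/eq_in_map => p pc /=; apply: inst_pterm => x px.
by have := cl p pc; rewrite px => /hasP[q qps /eqP /(h q)]; apply.
Qed.

(** A silent instruction is finished by this very step, so [k] moves on at once. A letter is emitted
    only later, by [All], and until then [k] stays the configuration being left. *)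
Lemma call_inv t s k b q : at_call s k -> step b (XTerm t s) q ->
  b = Ctl /\ exists s', q = XTerm t s' /\
    exists k', (k' = k \/ tau prog k k') /\ between t k' s'.
Proof.
move=> [args [st [-> stE gs e]]]; move qE : (XTerm t _) => q0 h.
case: h qE => // d args' sg t0 st' Dd gsg _ mE _ [? nE ? ?].
subst t0 args' st'.
split=> //; exists (SStrat (sbody d) :: SSubst sg :: pop_subst st); split=> //.
have -> : pop_subst st = [::] by case: stE => [->|[th ->]].
move: Dd => /in_map_iff[[[n ps] [a c]] [dE /In_mem ip]]; subst d.
move: mE nE => /= /(Forall2_map e) /map_peval[h1 h2] nE.
have kE : k = (n, map (peval (fun x => dec (sg (svar x)))) ps).
  by rewrite h2 -nE -surjective_pairing.
have cl c' : c = Some c' -> at_call [:: SStrat (call c'); SSubst sg]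
    (c'.1, map (peval (fun x => dec (sg (svar x)))) c'.2).
  move=> ce; rewrite ce in ip.
  exists (map pterm c'.2), [:: SSubst sg]; split=> //=.
    by right; exists sg.
  exact: closed_subst ip _.
have st1 := AStep (fun x => dec (sg (svar x))) ip.
rewrite -kE in st1.
case: a c ip st1 cl => [a|] [c|] ip /= st1 cl.
- exists k; split; first by left.
  apply: BEmit gsg st1 _; exact: cl.
- exists k; split; first by left.
  exact: BHalt gsg st1.
- exists (c.1, map (peval (fun x => dec (sg (svar x)))) c.2).
  split; first by right.
  by apply: BCall; exact: cl.
- exists k; split; first by left.
  exact: BFail.
Qed.

Lemma between_ctl t k s q : between t k s -> ctl defs (XTerm t s) q ->
  exists s', q = XTerm t s' /\
    exists k', (k' = k \/ tau prog k k') /\ between t k' s'.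
Proof.
case=> {s} [s /call_inv h /h[]//|st|a k' c th gs st1 cl|a k' c th gs st1 cl
  |a k' c th e st1 cl|a k' c th e st1 cl|a th gs st1|a th e st1|a e st1] h;
  inversion h; subst; eexists; split=> //; exists k; (split; first by left).
- exact: BMatch st1 cl.
- by apply: BSeq st1 cl; apply: matches_eqE; eauto.
- exact: BAll st1 cl.
- by apply: BPop st1; apply: matches_eqE; eauto.
- exact: BEnd st1.
Qed.

Lemma between_ctls t k s q : between t k s ->
  clos_refl_trans _ (ctl defs) (XTerm t s) q ->
  exists s', q = XTerm t s' /\ exists2 k', taus prog k k' & between t k' s'.
Proof.
move=> bs h; have h1 := clos_rt_rtn1 _ _ _ _ h.
elim: h1 => [|q1 q2 q12 _ [s1 [q1E [k1 kk1 b1]]]].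
  by exists s; split=> //; exists k => //; exact: rt_refl.
subst q1; have [s2 [-> [k2 [k12 b2]]]] := between_ctl b1 q12.
exists s2; split=> //; exists k2 => //; case: k12 => [->//|k12].
by apply: rt_trans kk1 _; exact: rt_step.
Qed.

Definition canon (q : xstate S) k : Prop :=
  exists t s, q = XTerm t s /\ at_call s k.

(** Among the stacks of [between] only that of [BAll] has a system step, and it is reached only
    after a match of the current term, which control steps leave unchanged. *)
Lemma bigstep_inv q q' k : canon q k -> bigstep defs q q' ->
  exists a k', [/\ eqE (cterm q) (emb (tm a)), emits prog a k k' & canon q' k'].
Proof.
move=> [t [s [-> /BCall-/(_ t) bs]]] [q1 /(between_ctls bs)[s' [-> [k1 kk1]]]].
case=> {s'} [s' /call_inv h /h[]//|st|a k' c th gs st1 cl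
  |a k' c th gs st1 cl
  |a k' c th e st1 cl|a k' c th e st1 cl|a th gs st1|a th e st1|a e st1] h;
  inversion h; subst.
exists a, k'; split=> //; first by exists k1.
by eexists; eexists; split=> //; exact: cl.
Qed.

Lemma solution_inv q t' k : canon q k ->
  clos_refl_trans _ (ctl defs) q (XTerm t' [::]) ->
  exists a, eqE (cterm q) (emb (tm a)) /\ halts prog a k.
Proof.
move=> [t [s [-> /BCall-/(_ t) bs]]] /(between_ctls bs)[s' [[<- sE]]].
case=> k1 kk1 h; rewrite -sE in h; inversion h; subst.
- by have [? [? []]] := H.
- by exists a; split=> //; exists k1.
Qed.

Lemma call_step t s k a n ps c v : at_call s k -> k = (n, map (peval v) ps) ->
  (n, ps, (a, c)) \in prog ->
  exists2 th, gsubst th &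
    ctl defs (XTerm t s)
      (XTerm t [:: SStrat (body (n, ps, (a, c))); SSubst th]) /\
    forall c', c = Some c' -> at_call [:: SStrat (call c'); SSubst th]
      (c'.1, map (peval v) c'.2).
Proof.
move=> [args [st [-> stE gs e]]] kE ip.
pose inps (x : nat) := has (fun q : pat G => q.2 == Some x) ps.
(* [TCall] admits no bindings outside the head of the definition, so [v] is restricted to the
   variables of [ps]. *)
pose th : subst S := fun y =>
  if y is (inr tt, x) then if inps x then enc (v x) else Var y else Var y.
have thE p x : p \in ps -> p.2 = Some x -> th (svar x) = enc (v x).
  move=> pps px; rewrite /th /=; case: ifP => // /hasPn/(_ p pps).
  by rewrite px eqxx.
have gth : gsubst th.
  move=> [[ky|[]] x]; rewrite /bound /th /=; first by case.
  case: ifP => _ b; last by case: b.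
  by split; [exact: enc_gterm | rewrite tkind_enc].
exists th => //; split; last first.
  move=> c' cE; rewrite cE in ip.
  exists (map pterm c'.2), [:: SSubst th]; split=> //=.
    by right; exists th.
  exact: closed_subst ip thE.
have -> : [:: SSubst th] = SSubst th :: pop_subst st.
  by case: stE => [->|[? ->]].
rewrite kE /= in e *.
have -> : n = sname (def (n, ps, (a, c))) by [].
apply: (@TCall _ _ _ (def (n, ps, (a, c)))) => //=.
- by apply/in_map_iff; exists (n, ps, (a, c)); split=> //; apply/In_mem.
- move=> [[ky|[]] x]; rewrite /bound /th /=; first by case.
  case: ifP => [/hasP[p pps /eqP px] _|_ []//].
  apply: Or32; exists (pterm p); last exact: occurs_pterm.
  by apply/in_map_iff; exists p; split=> //; apply/In_mem.
- move: (th) thE => {th gth kE ip inps}.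
  elim: ps args e => [|p ps IH] [|y args] //= [e1 e2] th thE.
  constructor; last first.
    by apply: IH => // q x qps; apply: thE; rewrite inE qps orbT.
  rewrite e1 (inst_pterm (v := v)); first by apply: ent_refl; exact: enc_gterm.
  by move=> x px; apply: (thE p) => //; rewrite inE eqxx.
Qed.

Lemma taus_ctls t s k k' : at_call s k -> taus prog k k' ->
  exists2 s', clos_refl_trans _ (ctl defs) (XTerm t s) (XTerm t s') &
    at_call s' k'.
Proof.
move=> cs h; have h1 := clos_rt_rtn1 _ _ _ _ h.
elim: h1 => [|k1 k2 k12 _ [s1 ss1 c1]]; first by exists s => //; exact: rt_refl.
rewrite /tau in k12; inversion k12 as [n ps a c v ip aE kE cE]; subst.
case: c ip cE {k12} => [c|//] ip [<-].
have [th _ [h2 /(_ c erefl) c2]] := call_step t c1 erefl ip.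
exists [:: SStrat (call c); SSubst th] => //.
by apply: rt_trans ss1 _; apply: rt_step.
Qed.

Lemma bigstep_emits t s k a k' t' : at_call s k -> emits prog a k k' ->
  eqE t (emb (tm a)) -> Defs.step t t' ->
  exists2 s', bigstep defs (XTerm t s) (XTerm t' s') & at_call s' k'.
Proof.
move=> cs [k1 kk1 k1k'] e [ct st].
have [s1 ss1 c1] := taus_ctls t cs kk1.
inversion k1k' as [n ps a' c v ip aE kE cE]; subst.
case: c ip cE {k1k'} => [c|//] ip [<-].
have [th gth [h2 /(_ c erefl) c2]] := call_step t c1 erefl ip.
exists [:: SStrat (call c); SSubst th] => //.
eexists; last by apply: (@TAll _ _ _ false) st.
apply: rt_trans ss1 _; apply: rt_trans (rt_step _ _ _ _ h2) _.
apply: rt_trans (rt_step _ _ _ _ (TSeq _ _ _ _ _ _)) _.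
apply: rt_trans (rt_step _ _ _ _ (TMatch _ _ (eqE_matches _ e))) _ => //.
exact: rt_step (TSeq _ _ _ _ _ _).
Qed.

Lemma solution_halts t s k a : at_call s k -> halts prog a k ->
  eqE t (emb (tm a)) ->
  clos_refl_trans _ (ctl defs) (XTerm t s) (XTerm t [::]).
Proof.
move=> cs [k1 kk1 k1h] e.
have [s1 ss1 c1] := taus_ctls t cs kk1.
inversion k1h as [n ps a' c v ip aE kE cE]; subst.
case: c ip cE {k1h} => [//|] ip _.
have [th gth [h2 _]] := call_step t c1 erefl ip.
apply: rt_trans ss1 _; apply: rt_trans (rt_step _ _ _ _ h2) _.
apply: rt_trans (rt_step _ _ _ _ (TMatch _ _ (eqE_matches _ e))) _ => //.
exact: rt_step (TPop _ _ _ _ _).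
Qed.

Definition letter (a : A) : set (term S) := cls (emb (tm a)).

Lemma at_call_start n : at_call [:: SStrat (Call n [::])] (n, [::]).
Proof. by exists [::], [::]; split=> //; left. Qed.

Lemma frun_sound n (q : nat -> xstate S) k t : canon (q 0) k ->
  (forall i, (i < n)%N -> bigstep defs (q i) (q i.+1)) ->
  clos_refl_trans _ (ctl defs) (q n) (XTerm t [::]) ->
  exists2 s, frun prog s k &
    map (fun q => cls (cterm q)) (mkseq q n.+1) = map letter s.
Proof.
elim: n q k => [|n IH] q k cq bs sol.
  have [a [e h]] := solution_inv cq sol.
  by exists [:: a]; [left | rewrite /= (eqE_cls e)].
have [a [k' [e h cq']]] := bigstep_inv cq (bs 0 isT).
have [//|s hs es] := IH (fun i => q i.+1) k' cq' (fun i => bs i.+1).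
exists (a :: s); first by right; exists k'.
by rewrite mkseq_cons map_cons es (eqE_cls e).
Qed.

Lemma live_sound (q : nat -> xstate S) k : canon (q 0) k ->
  (forall i, bigstep defs (q i) (q i.+1)) ->
  exists2 s, live prog s 0 k & forall i, cls (cterm (q i)) = letter (s i).
Proof.
move=> cq bs.
have [|K [K0 Kc KS]] := dependent_choice (P := fun i => canon (q i))
  (Q := fun i k k' => exists2 a, cls (cterm (q i)) = letter a &
          emits prog a k k') cq.
  move=> i k1 ck; have [a [k' [e h ck']]] := bigstep_inv ck (bs i).
  by exists k' => //; exists a => //; exact: eqE_cls e.
have [s sP] := choice (fun i => let: ex_intro2 a e h := KS i in
  ex_intro (fun a => cls (cterm (q i)) = letter a /\
                     emits prog a (K i) (K i.+1)) a (conj e h)).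
by exists s => [|i]; [exists K; split=> // i | ]; have [] := sP i.
Qed.

Lemma Elang_sound n w : Elang defs (Call n [::]) w ->
  (exists2 s, frun prog s (n, [::]) & w = Fin (map letter s)) \/
  (exists2 s, live prog s 0 (n, [::]) & w = Inf (letter \o s)).
Proof.
move=> [t gt [w' [[m [q [-> q0 bs [t' [_ sol]]]]]|[q [-> q0 bs]]] <-]].
  left; have [|s hs es] := frun_sound (k := (n, [::])) _ bs sol.
    by rewrite q0; eexists; eexists; split=> //; exact: at_call_start.
  by exists s; rewrite // /wmap es.
right; have [|s hs es] := live_sound (k := (n, [::])) _ bs.
  by rewrite q0; eexists; eexists; split=> //; exact: at_call_start.
by exists s => //=; congr Inf; apply: funext => i; exact: es.
Qed.

Lemma emb_letter_step a b : Defs.step (tm a) (tm b) ->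
  Defs.step (emb (tm a)) (emb (tm b)).
Proof. by case=> c h; eexists; exact: emb_step h. Qed.

(** The execution goes through the chosen representatives themselves: every match holds by
    reflexivity, and only steps between consecutive representatives are needed. *)
Lemma frun_complete s st k a : at_call st k ->
  frun prog (a :: s) k ->
  (forall s1 b c s2, a :: s = s1 ++ b :: c :: s2 -> Defs.step (tm b) (tm c)) ->
  exists q : nat -> xstate S,
    [/\ q 0 = XTerm (emb (tm a)) st,
        forall i, (i < size s)%N -> bigstep defs (q i) (q i.+1),
        exists t', gterm t' /\
          clos_refl_trans _ (ctl defs) (q (size s)) (XTerm t' [::]) &
        map (fun q => cls (cterm q)) (mkseq q (size s).+1) =
        map letter (a :: s)].
Proof.
elim: s st k a => [|b s IH] st k a ck.
  case=> [[_ h] _|[? _ []]].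
  have eaa : eqE (emb (tm a)) (emb (tm a)) by apply/ent_refl/gterm_emb.
  exists (fun _ => XTerm (emb (tm a)) st); split=> //.
  exists (emb (tm a)); split; first exact: gterm_emb.
  exact: solution_halts h eaa.
case=> [[//]|[k' h hs]] steps.
have eaa : eqE (emb (tm a)) (emb (tm a)) by apply/ent_refl/gterm_emb.
have ab : Defs.step (emb (tm a)) (emb (tm b)).
  by apply: emb_letter_step; exact: (steps [::] a b s).
have [st' bs ck'] := bigstep_emits ck h eaa ab.
have [|q [q0 qS sol qE]] := IH st' k' b ck' hs.
  by move=> s1 c d s2 e; apply: (steps (a :: s1) c d s2); rewrite e.
exists (fun i => if i is i.+1 then q i else XTerm (emb (tm a)) st).
split=> //.
- by move=> [|i] //= il; [rewrite q0 | exact: qS].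
- by rewrite mkseq_cons map_cons qE.
Qed.

Lemma Elang_fin n s : s <> [::] -> frun prog s (n, [::]) ->
  (forall s1 b c s2, s = s1 ++ b :: c :: s2 -> Defs.step (tm b) (tm c)) ->
  Elang defs (Call n [::]) (Fin (map letter s)).
Proof.
case: s => [//|a s] _ hs steps.
have [q [q0 qS sol qE]] := frun_complete (at_call_start n) hs steps.
exists (tm a) => //; exists (Fin (mkseq q (size s).+1)); last by rewrite -qE.
by left; exists (size s), q.
Qed.

Lemma Elang_inf n s : live prog s 0 (n, [::]) ->
  (forall i, Defs.step (tm (s i)) (tm (s i.+1))) ->
  Elang defs (Call n [::]) (Inf (letter \o s)).
Proof.
move=> [K [K0 KS]] steps.
pose P i (st : stack S) := at_call st (K i).
pose Q i st st' :=
  bigstep defs (XTerm (emb (tm (s i))) st) (XTerm (emb (tm (s i.+1))) st').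
have [||st [st0 _ stS]] :=
  dependent_choice (P := P) (Q := Q) (x0 := [:: SStrat (Call n [::])]).
- by rewrite /P K0; exact: at_call_start.
- move=> i st ck.
  apply: (bigstep_emits ck (KS i)); last exact: emb_letter_step.
  by apply/ent_refl/gterm_emb.
exists (tm (s 0)) => //.
exists (Inf (fun i => XTerm (emb (tm (s i))) (st i))) => //.
right; exists (fun i => XTerm (emb (tm (s i))) (st i)).
by split=> //; rewrite st0.
Qed.

End Strategies.

(** * Turing machines that visit their input lazily *)

Section Glue.
Context (T : Type).

Fixpoint glue (s : seq T) (f : nat -> T) : nat -> T :=
  if s is x :: s then fun i => if i is i.+1 then glue s f i else x else f.

Lemma glue_cat s1 s2 f : glue (s1 ++ s2) f = glue s1 (glue s2 f).
Proof. by elim: s1 => [//|x s1 IH] /=; rewrite IH. Qed.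

Lemma glue_at u a r f : glue (u ++ a :: r) f (size u) = a.
Proof. by elim: u => //=. Qed.

Lemma glue_set u a b r f :
  (fun i => if i == size u then b else glue (u ++ a :: r) f i) =
  glue (u ++ b :: r) f.
Proof.
apply: funext => i; elim: u i => [|x u IH] [|i] //=.
by rewrite -IH eqSS.
Qed.

Lemma nth_glue x0 s : nth x0 s = glue s (fun _ => x0).
Proof.
by apply: funext => i; elim: s i => [|x s IH] [|i] //=; rewrite nth_nil.
Qed.

End Glue.

Section Machine.
Context (A : finType) (M : machine A).
Notation Q := (mstate M).
Notation B := (msym M).

(* A state, the tape to the left of the head (reversed), the visited tape from
   the head on, and input that has not been visited yet. *)
Definition sconf := (Q * seq B * seq B * seq A)%type.

(* [bl]: blanks follow the input. *)
Inductive simstep (bl : bool) : sconf -> sconf -> Prop :=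
  | SRight q a q' b l r w : mdelta q a q' b MoveR ->
      simstep bl (q, l, a :: r, w) (q', b :: l, r, w)
  | SStay q a q' b l r w : mdelta q a q' b Stay ->
      simstep bl (q, l, a :: r, w) (q', l, b :: r, w)
  | SLeft q a q' b c l r w : mdelta q a q' b MoveL ->
      simstep bl (q, c :: l, a :: r, w) (q', l, c :: b :: r, w)
  | SLeft0 q a q' b r w : mdelta q a q' b MoveL ->
      simstep bl (q, [::], a :: r, w) (q', [::], b :: r, w)
  | SRead q l a w :
      simstep bl (q, l, [::], a :: w) (q, l, [:: @minput _ M a], w)
  | SBlank q l : bl ->
      simstep bl (q, l, [::], [::]) (q, l, [:: mblank M], [::]).

Definition sims bl := clos_refl_trans _ (simstep bl).

(** [g] is the tape beyond the stored part: blanks for a finite word, the letters not guessed yet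
    for an infinite one. *)
Definition rep (c : config M) (x : sconf) (g : nat -> B) : Prop :=
  let: (q, l, r, w) := x in
  [/\ cstate c = q, cpos c = size l &
      ctape c = glue (rev l ++ r ++ map (@minput _ M) w) g].

(** The number of tape cells known to the simulation, an invariant of all steps but [SBlank]. *)
Definition total (x : sconf) : nat :=
  let: (q, l, r, w) := x in (size l + size r + size w)%N.

(** The equation on [g] says that it consists of blanks only. *)
Lemma rep_blank c q l g : glue [:: mblank M] g = g ->
  rep c (q, l, [::], [::]) g -> rep c (q, l, [:: mblank M], [::]) g.
Proof. by move=> bg [cq cp ct]; split=> //; rewrite ct !glue_cat bg. Qed.

Lemma sim_sound (bl : bool) c x y g : (bl -> glue [:: mblank M] g = g) ->
  rep c x g -> simstep bl x y ->
  exists2 c', c' = c \/ mnext c c' & rep c' y g.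
Proof.
move=> blg + h; case: h => {x y}
  [q a q' b l r w h|q a q' b l r w h|q a q' b d l r w h|q a q' b r w h
  |q l a w|q l blT] [cq cp ct].
- have aE : ctape c (cpos c) = a by rewrite cp ct -size_rev glue_at.
  exists (Config q' (fun i => if i == cpos c then b else ctape c i)
    (cpos c).+1).
    by right; exists b, MoveR; split=> //=; rewrite aE cq.
  split=> //=; first by rewrite cp.
  by rewrite cp ct -size_rev glue_set rev_cons cat_rcons.
- have aE : ctape c (cpos c) = a by rewrite cp ct -size_rev glue_at.
  exists (Config q' (fun i => if i == cpos c then b else ctape c i) (cpos c)).
    by right; exists b, Stay; split=> //=; rewrite aE cq.
  by split=> //=; rewrite cp ct -size_rev glue_set.
- have aE : ctape c (cpos c) = a by rewrite cp ct -size_rev glue_at.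
  exists (Config q' (fun i => if i == cpos c then b else ctape c i)
    (cpos c).-1).
    by right; exists b, MoveL; split=> //=; rewrite aE cq.
  split=> //=; first by rewrite cp.
  by rewrite cp ct -size_rev glue_set rev_cons cat_rcons.
- have aE : ctape c (cpos c) = a by rewrite cp ct.
  exists (Config q' (fun i => if i == cpos c then b else ctape c i)
    (cpos c).-1).
    by right; exists b, MoveL; split=> //=; rewrite aE cq.
  split=> //=; first by rewrite cp.
  by rewrite cp ct /=; exact: (glue_set [::]).
- by exists c; [left | split].
- by exists c; [left | apply: rep_blank; [exact: blg | split]].
Qed.

Lemma sim_complete bl c c' q l a r w g : rep c (q, l, a :: r, w) g ->
  mnext c c' ->
  exists q' l' r', [/\ simstep bl (q, l, a :: r, w) (q', l', r', w),
    rep c' (q', l', r', w) g & total (q', l', r', w) = total (q, l, a :: r, w)].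
Proof.
move=> [cq cp ct] [b [d [h cp' ct']]].
have aE : ctape c (cpos c) = a by rewrite cp ct -size_rev glue_at.
rewrite aE cq in h; rewrite cp ct -size_rev glue_set in ct'.
rewrite cp in cp'.
case: d h cp' => /= h cp'.
- case: l cp ct ct' cp' {aE} => [|e l] cp ct ct' cp'.
    by exists (cstate c'), [::], (b :: r); split=> //; exact: SLeft0.
  exists (cstate c'), l, (e :: b :: r); split; first exact: SLeft.
    by split=> //; rewrite ct' rev_cons cat_rcons.
  by move=> /=; lia.
- exists (cstate c'), (b :: l), r; split; first exact: SRight.
    by split=> //; rewrite ct' rev_cons cat_rcons.
  by move=> /=; lia.
- by exists (cstate c'), l, (b :: r); split=> //; exact: SStay.
Qed.

Lemma total_simstep x y : simstep false x y -> total x = total y.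
Proof. by case=> //= *; lia. Qed.

Lemma sims_sound (bl : bool) c x y g : (bl -> glue [:: mblank M] g = g) ->
  rep c x g -> sims bl x y ->
  exists2 c', clos_refl_trans _ (@mnext _ M) c c' & rep c' y g.
Proof.
move=> blg cx h; have h1 := clos_rt_rtn1 _ _ _ _ h.
elim: h1 => [|u v uv _ [c1 cc1 c1u]]; first by exists c => //; exact: rt_refl.
have [c2 [c21|h2] c2v] := sim_sound blg c1u uv; exists c2 => //.
  by rewrite c21.
by apply: rt_trans cc1 _; exact: rt_step.
Qed.

Lemma accepts_finE s : accepts_fin M s <->
  exists q l r w, sims true (mstart M, [::], [::], s) (q, l, r, w) /\
    q \in mfinal M.
Proof.
pose g (_ : nat) := mblank M.
have blg : true -> glue [:: mblank M] g = g.
  by move=> _; apply: funext => -[].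
have r0 : rep (init_config (nth (mblank M) (map (@minput _ M) s)))
    (mstart M, [::], [::], s) g by split=> //=; rewrite nth_glue.
split=> [[c [h fc]]|[q [l [r [w [h fq]]]]]]; last first.
  have [c h' [cq _ _]] := sims_sound blg r0 h.
  by exists c; rewrite cq.
suff [[[[q l] r] w] h' [cq _ _]] : exists2 x,
    sims true (mstart M, [::], [::], s) x & rep c x g.
  by exists q, l, r, w; split=> //; rewrite -cq.
have h1 := clos_rt_rtn1 _ _ _ _ h.
elim: h1 => {c h fc} [|c c' cc' _ [[[[q l] r] w] h cx]].
  by eexists; [exact: rt_refl | exact: r0].
(* If the head has left the visited part, the cell under it is fetched first, from the input or as a
   blank. *)
have [a [r' [w' [h2 cx']]]] : exists a r' w',
    sims true (q, l, r, w) (q, l, a :: r', w') /\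
    rep c (q, l, a :: r', w') g.
  case: r h cx => [|a r] h cx; last first.
    by exists a, r, w; split=> //; exact: rt_refl.
  case: w h cx => [|a w] h cx.
    exists (mblank M), [::], [::]; split; last exact: rep_blank (blg isT) cx.
    by apply: rt_step; exact: SBlank.
  exists (@minput _ M a), [::], w; split=> //; apply: rt_step; exact: SRead.
have [q' [l' [r1 [st cy _]]]] := sim_complete true cx' cc'.
exists (q', l', r1, w') => //.
by apply: rt_trans h _; apply: rt_trans h2 _; exact: rt_step.
Qed.


Definition seg (T : Type) (s : nat -> T) (i j : nat) : seq T :=
  map s (index_iota i j).

Lemma seg_nil (T : Type) (s : nat -> T) i : seg s i i = [::].
Proof. by rewrite /seg /index_iota subnn. Qed.

Lemma seg_cat (T : Type) (s : nat -> T) i j k : (i <= j <= k)%N ->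
  seg s i k = seg s i j ++ seg s j k.
Proof.
move=> /andP[ij jk]; rewrite /seg /index_iota -map_cat.
have -> : (k - i = (j - i) + (k - j))%N by lia.
by rewrite iotaD subnKC.
Qed.

Lemma seg_cons (T : Type) (s : nat -> T) i j : (i < j)%N ->
  seg s i j = s i :: seg s i.+1 j.
Proof.
move=> ij; rewrite (seg_cat s (j := i.+1)) ?leqnSn //.
by rewrite /seg /index_iota subSnn.
Qed.

Lemma glue_seg (T U : Type) (f : T -> U) (s : nat -> T) i j : (i <= j)%N ->
  glue (map f (seg s i j)) (fun x => f (s (j + x)%N)) =
  fun x => f (s (i + x)%N).
Proof.
move=> /subnKC <-; move: (j - i)%N => {j} d; elim: d i => [|d IH] i.
  by rewrite addn0 seg_nil.
rewrite seg_cons; last by lia.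
apply: funext => -[|x] /=; first by rewrite addn0.
by have := f_equal (fun g => g x) (IH i.+1); rewrite !addSnnS.
Qed.

(** * Buchi acceptance in terms of blocks of input *)

Definition initial : sconf := (mstart M, [::], [::], [::]).

Definition with_input (x : sconf) (w : seq A) : sconf :=
  let: (q, l, r, _) := x in (q, l, r, w).

Definition final (x : sconf) : bool := x.1.1.1 \in mfinal M.

(* Since the blocks are nonempty the run is complete, and since each of them
   ends in a final state it meets the Buchi condition. *)
Definition blocks (s : nat -> A) (n : nat -> nat) (x : nat -> sconf) : Prop :=
  [/\ n 0 = 0, x 0 = initial &
      forall k, [/\ (n k < n k.+1)%N,
        sims false (with_input (x k) (seg s (n k) (n k.+1))) (x k.+1),
        (x k.+1).2 = [::] & final (x k.+1)]].

(** The step that uses up the input is an [SRead]. At that moment nothing is stored from the head on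
    except the letter being read, so the head is on the last of the [total x] cells. *)
Lemma sims_visit x y c g : rep c x g -> sims false x y ->
  x.2 <> [::] -> y.2 = [::] ->
  exists e c', [/\ clos_refl_trans _ (@mnext _ M) c e,
    (cpos e).+1 = total x, clos_refl_trans _ (@mnext _ M) e c' & rep c' y g].
Proof.
have nbl : false -> glue [:: mblank M] g = g by [].
move=> cx h; have h1 := clos_rt_rt1n _ _ _ _ h.
elim: h1 c cx => {x y h} [x c _ x2 /x2//|x y z xy h1 IH c cx x2 z2].
have yz := clos_rt1n_rt _ _ _ _ h1.
have [y2|y2] := pselect (y.2 = [::]); last first.
  have [c1 cc1 c1y] := sim_sound nbl cx xy.
  have [e [c' [c1e eP ec' c'z]]] := IH c1 c1y y2 z2.
  exists e, c'; split=> //; last by rewrite (total_simstep xy).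
  by case: cc1 => [<- //|cc1]; apply: rt_trans c1e; exact: rt_step.
have [c1 cc1 c1y] := sim_sound nbl cx xy.
have [c' c1c' c'z] := sims_sound nbl c1y yz.
exists c, c'; split=> //; first exact: rt_refl.
  case: xy cx x2 y2 {IH yz cc1 c1y} => //= q l a w [_ -> _] _ ->.
  by rewrite /= addn0 addn1.
by case: cc1 => [<- //|cc1]; apply: rt_trans c1c'; exact: rt_step.
Qed.

(** A finite run is a sequence with its last index; the later values are arbitrary. *)
Definition trajectory (c0 : config M) (fN : (nat -> config M) * nat) : Prop :=
  fN.1 0 = c0 /\ forall i, (i < fN.2)%N -> mnext (fN.1 i) (fN.1 i.+1).

Definition prolongs (fN fN' : (nat -> config M) * nat) : Prop :=
  (fN.2 <= fN'.2)%N /\ forall i, (i <= fN.2)%N -> fN'.1 i = fN.1 i.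

Lemma prolong c0 fN c : trajectory c0 fN ->
  clos_refl_trans _ (@mnext _ M) (fN.1 fN.2) c ->
  exists fN', [/\ trajectory c0 fN', prolongs fN fN' & fN'.1 fN'.2 = c].
Proof.
move=> tr h; have h1 := clos_rt_rtn1 _ _ _ _ h.
elim: h1 => [|c1 c2 c12 _ [[f N] [[f0 fS] [NN ff] fN1]]]; first by exists fN.
rewrite /= in f0 fS NN ff fN1.
exists (fun i => if (i <= N)%N then f i else c2, N.+1); split=> /=.
- split=> //= i; rewrite ltnS => iN; rewrite iN.
  by case: ltngtP iN => // [iN|->] _; [exact: fS | rewrite fN1].
- by split=> [|i iN] /=; [exact: leqW | rewrite (leq_trans iN NN) ff].
- by rewrite ltnn.
Qed.

Lemma trajectory_pos c0 fN i : trajectory c0 fN -> cpos c0 = 0 ->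
  (i <= fN.2)%N -> (cpos (fN.1 i) <= i)%N.
Proof.
move=> [f0 fS] c00; elim: i => [_|i IH iN]; first by rewrite f0 c00.
have [_ [d [_ -> _]]] := fS i iN; have := IH (ltnW iN).
by case: d => /=; lia.
Qed.

(** A discrete intermediate value theorem, applied to the position of the head. *)
Lemma reach_pos (g : nat -> nat) p n : g 0 = 0 ->
  (forall i, (g i.+1 <= (g i).+1)%N) -> (p <= g n)%N -> exists i, g i = p.
Proof.
move=> g0 gS; elim: n => [|n IH].
  by rewrite g0 leqn0 => /eqP->; exists 0.
move=> pg; case: (leqP p (g n)) => [/IH//|gp]; exists n.+1.
by apply/eqP; rewrite eqn_leq pg andbT; apply: leq_trans gp.
Qed.

Lemma blocks_accepts s n x : blocks s n x -> accepts_inf M s.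
Proof.
move=> [n0 x0 xS].
pose g k (i : nat) := @minput _ M (s (n k + i)%N).
have n_ge k : (k <= n k)%N.
  by elim: k => [//|k IH]; have [? _ _ _] := xS k; apply: leq_ltn_trans IH _.
have xk2 k : (x k).2 = [::] by case: k => [|k]; [rewrite x0 | have [] := xS k].
(* All letters handed over so far have been read, so [total] counts them. This locates the last
   position of each block. *)
have totx k : total (x k) = n k.
  elim: k => [|k IH]; first by rewrite n0 x0.
  have [lt h _ _] := xS k.
  have -> : total (x k.+1) = total (with_input (x k) (seg s (n k) (n k.+1))).
    have h1 := clos_rt_rt1n _ _ _ _ h.
    by elim: h1 => // a b c /total_simstep -> _ ->.
  move: IH (xk2 k); case: (x k) => [[[q l] r] w] /= tot w0.
  by rewrite w0 /= addn0 in tot; rewrite size_map size_iota; lia.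
pose c0 : config M := init_config (@minput _ M \o s).
pose P k fN := trajectory c0 fN /\ rep (fN.1 fN.2) (x k) (g k).
pose E k (fN fN' : (nat -> config M) * nat) := prolongs fN fN' /\
  exists2 m, (m <= fN'.2)%N & (cpos (fN'.1 m)).+1 = n k.+1.
have [||F [F0 FP FE]] := dependent_choice (P := P) (Q := E)
    (x0 := (fun=> c0, 0)).
- split; first by split.
  by rewrite x0 /=; split=> //=; apply: funext => i; rewrite /g n0.
- move=> k fN [tr cx]; have [lt h _ _] := xS k.
  have cx' : rep (fN.1 fN.2) (with_input (x k) (seg s (n k) (n k.+1))) (g k.+1).
    move: cx (xk2 k); case: (x k) => [[[q l] r] w] /= [cq cp ct] w0.
    split=> //; rewrite ct w0 !glue_cat glue_seg //; exact: ltnW.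
  have [||e [c' [ce eP ec' c'x]]] := sims_visit cx' h.
  + case: (x k) => [[[q l] r] w] /= /(f_equal size).
    by rewrite size_map size_iota /=; lia.
  + by have [] := xS k.
  have [fN1 [tr1 p1 e1]] := prolong tr ce.
  have [fN2 [tr2 p2 e2]] : exists fN', [/\ trajectory c0 fN', prolongs fN1 fN'
      & fN'.1 fN'.2 = c'] by apply: prolong => //; rewrite e1.
  exists fN2; last by split=> //; rewrite e2.
  split; first split.
  + exact: leq_trans p1.1 p2.1.
  + by move=> i iN; rewrite p2.2 ?p1.2 // (leq_trans iN p1.1).
  + exists fN1.2; first exact: p2.1.
    rewrite p2.2 // e1 eP.
    move: (totx k) (xk2 k); case: (x k) => [[[q l] r] w] /= tot w0.
    by rewrite w0 /= addn0 in tot; rewrite size_map size_iota; lia.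
have trF k : trajectory c0 (F k) by have [] := FP k.
(* The head starts at 0 and moves by at most one cell per step, so visiting the last position of
   block [k] takes at least [k] steps: the finite runs grow beyond any bound. *)
have N_ge k : (k <= (F k.+1).2)%N.
  have [_ [m mN mE]] := FE k.
  have := trajectory_pos (trF k.+1) erefl mN; have := n_ge k.+1; lia.
have agree j d i : (i <= (F j).2)%N ->
    (i <= (F (j + d)).2)%N /\ (F (j + d)).1 i = (F j).1 i.
  move=> iN; elim: d => [|d [IH1 IH2]]; first by rewrite addn0.
  have [[NN ff] _] := FE (j + d)%N; rewrite addnS ff //; split=> //.
  exact: leq_trans IH1 NN.
(* A diagonal: stage [i.+1] is long enough to be meaningful at time [i], and the later stages agree
   with it. *)
pose run i := (F i.+1).1 i.
have runE j i : (i <= (F j).2)%N -> run i = (F j).1 i.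
  move=> iN; have [_ <-] := agree j i.+1 i iN.
  by have [_] := agree i.+1 j i (N_ge i); rewrite addnC /run => <-.
exists run; split.
- by have [] := trF 1.
- move=> i; rewrite (runE i.+2 i) ?(runE i.+2 i.+1) //;
    last exact: ltnW (N_ge _).
  by have [_] := trF i.+2; apply; exact: N_ge.
- move=> p; have [_ [m mN mE]] := FE p.
  apply: (@reach_pos (fun i => cpos (run i)) p m).
  + by rewrite /run; have [-> _] := trF 1.
  + move=> i; rewrite (runE i.+2 i) ?(runE i.+2 i.+1) //;
      last exact: ltnW (N_ge _).
    have [_ /(_ i (N_ge _))[_ [d [_ -> _]]]] := trF i.+2.
    by case: d => /=; lia.
  + by rewrite (runE p.+1) //; have := n_ge p.+1; lia.
- move=> i; exists (F i.+1).2; first exact: N_ge.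
  rewrite (runE i.+1) //; have [_] := FP i.+1.
  have [_ _ _] := xS i; rewrite /final.
  by case: (x i.+1) => [[[q l] r] w] /= fq [-> _ _].
Qed.

(** This needs the absence of blanks: [SBlank] requires that no input is left. *)
Lemma sims_frame q l r w y u : sims false (q, l, r, w) y ->
  sims false (q, l, r, w ++ u) (with_input y (y.2 ++ u)).
Proof.
move=> h; have h1 := clos_rt_rtn1 _ _ _ _ h.
elim: h1 => [|y1 y2 y12 _ IH]; first exact: rt_refl.
apply: rt_trans IH _; apply: rt_step.
by case: y12 => //= *; constructor.
Qed.

Lemma accepts_blocks s : accepts_inf M s -> exists n x, blocks s n x.
Proof.
move=> [run [run0 runS runC runF]].
pose g j (i : nat) := @minput _ M (s (j + i)%N).
(* The strict bound concerns times before [t] only: at time [t] the head may stand on position [j],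
   whose letter is still unread. That [j] was not visited earlier is what makes the blocks nonempty
   below. *)
pose I t j (x : sconf) := [/\ x.2 = [::], rep (run t) x (g j), total x = j &
  forall i, (i < t)%N -> (cpos (run i) < j)%N].
have I1 t j x : I t j x -> exists j' x', [/\ (j <= j')%N,
    sims false (with_input x (seg s j j')) x' & I t.+1 j' x'].
  case: x => [[[q l] r] w] [/= w0 cx tot vis]; rewrite w0 /= addn0 in cx tot *.
  (* The case of a known cell under the head. If there is none, the next letter of [s] is read first
     and [j] grows by one. *)
  have read b r' j' : total (q, l, b :: r', [::]) = j' -> (j <= j')%N ->
      sims false (q, l, r, seg s j j') (q, l, b :: r', [::]) ->
      rep (run t) (q, l, b :: r', [::]) (g j') ->
      exists j'' x', [/\ (j <= j'')%N,
        sims false (q, l, r, seg s j j'') x' & I t.+1 j'' x'].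
    move=> tot' jj' h cx'.
    have [q' [l' [r1 [st cy ty]]]] := sim_complete false cx' (runS t).
    exists j', (q', l', r1, [::]); split=> //.
      by apply: rt_trans h _; exact: rt_step.
    split=> //; first by rewrite ty.
    move=> i; rewrite ltnS leq_eqVlt => /orP[/eqP->|/vis it].
      by case: cx' => _ -> _; rewrite -tot' /=; lia.
    exact: leq_trans it jj'.
  case: r cx tot read => [|b r] cx tot read.
    apply: (read (@minput _ M (s j)) [::] j.+1) => //.
    + by move=> /=; rewrite addn0 in tot; lia.
    + rewrite seg_cons // seg_nil; apply: rt_step; exact: SRead.
    + case: cx => cq cp ct; split=> //; rewrite ct /= cats0 !glue_cat /=.
      congr glue; apply: funext => -[|i]; first by rewrite /g addn0.
      by rewrite /g addnS.
  apply: (read b r j) => //; first by rewrite /= addn0.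
  by rewrite seg_nil; exact: rt_refl.
have In t j x d : I t j x -> exists j' x', [/\ (j <= j')%N,
    sims false (with_input x (seg s j j')) x' & I (t + d)%N j' x'].
  move=> Ix; elim: d => [|d [j1 [x1 [jj1 h1 Ix1]]]].
    exists j, x; rewrite addn0; split=> //.
    rewrite seg_nil; case: x Ix => [[[q l] r] w] [/= -> _ _ _].
    exact: rt_refl.
  have [j2 [x2 [j12 h2 Ix2]]] := I1 _ _ _ Ix1.
  exists j2, x2; rewrite addnS; split=> //; first exact: leq_trans j12.
  apply: rt_trans h2; rewrite (@seg_cat _ _ j j1 j2) ?jj1 //.
  case: x h1 {Ix} => [[[q l] r] w] /= /(sims_frame (seg s j1 j2)).
  by case: Ix1 => -> _ _ _.
pose P (k : nat) (tjx : nat * nat * sconf) := I tjx.1.1 tjx.1.2 tjx.2.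
pose E (k : nat) (y z : nat * nat * sconf) := [/\ (y.1.2 < z.1.2)%N,
  sims false (with_input y.2 (seg s y.1.2 z.1.2)) z.2, z.2.2 = [::] &
  final z.2].
have [||F [F0 FP FE]] := dependent_choice (P := P) (Q := E)
    (x0 := (0, 0, initial)).
- by rewrite /P /=; split=> //=; rewrite run0; split.
- move=> k [[t j] x] Ix; rewrite /P /= in Ix.
  (* Completeness gives a time [m] at which the head is on the new position [j]. Simulating past
     [m], up to a time not before [t] in a final state, yields a nonempty block that ends in a final
     state. *)
  have [m mj] := runC j; have [t' tt' ft'] := runF (maxn t m.+1).
  have [j' [x' [jj' h Ix']]] := In _ _ _ (t' - t)%N Ix.
  rewrite subnKC in Ix'; last by rewrite (leq_trans _ tt') // leq_maxl.
  exists (t', j', x') => //; rewrite /E /=.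
  case: Ix' => x'2 cx' _ vis; split=> //.
    by rewrite -mj; apply: vis; rewrite (leq_trans _ tt') // leq_maxr.
  by move: cx'; rewrite /final; case: (x') => [[[q l] r] w] [/= <- _ _].
exists (fun k => (F k).1.2), (fun k => (F k).2).
by split; rewrite ?F0 // => k; exact: FE.
Qed.

End Machine.

(** * The strategy of a pair of machines *)

Section Families.
Context (G A : finType).
Implicit Types (p : seq (instr G A)) (i : instr G A) (k : conf G).

Definition fires i (v : nat -> seq G) a k (o : option (conf G)) : Prop :=
  [/\ a = i.2.1, k = (i.1.1, map (peval v) i.1.2) &
      o = omap (fun c : nat * seq (pat G) => (c.1, map (peval v) c.2)) i.2.2].

Definition fam (T : finType) (P : pred T) (f : T -> instr G A) :=
  [seq f x | x <- enum P].

Lemma astepE p a k o :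
  astep p a k o <-> exists2 i, i \in p & exists v, fires i v a k o.
Proof.
split=> [[n ps b c v ip]|[[[n ps] [b c]] ip [v [/= -> -> ->]]]].
  by exists (n, ps, (b, c)) => //; exists v.
exact: AStep ip.
Qed.

Lemma astep_cat p1 p2 a k o :
  astep (p1 ++ p2) a k o <-> astep p1 a k o \/ astep p2 a k o.
Proof.
rewrite !astepE; split=> [[i]|[[i ip f]|[i ip f]]].
- by rewrite mem_cat => /orP[ip|ip] f; [left|right]; exists i.
- by exists i => //; rewrite mem_cat ip.
- by exists i => //; rewrite mem_cat ip orbT.
Qed.

Lemma astep1 i a k o : astep [:: i] a k o <-> exists v, fires i v a k o.
Proof.
rewrite astepE; split=> [[j]|f]; first by rewrite inE => /eqP->.
by exists i => //; rewrite inE.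
Qed.

Lemma astep_fam (T : finType) (P : pred T) (f : T -> instr G A) a k o :
  astep (fam P f) a k o <-> exists2 x, P x & exists v, fires (f x) v a k o.
Proof.
rewrite astepE; split=> [[i /mapP[x]]|[x Px h]].
  by rewrite mem_enum => Px -> h; exists x.
by exists (f x) => //; apply: map_f; rewrite mem_enum.
Qed.

Lemma all_fam (T : finType) (P : pred T) (f : T -> instr G A)
    (q : pred (instr G A)) :
  (forall x, q (f x)) -> all q (fam P f).
Proof. by move=> h; rewrite /fam all_map; apply/allP => x _; exact: h. Qed.

End Families.

(** * Turing machine steps as instructions *)

Section Simulation.
Context (A : finType) (M : machine A) (G : finType).
Context (eA : A -> G) (eQ : mstate M -> G) (eB : msym M -> G).
Hypotheses (eA_inj : injective eA) (eQ_inj : injective eQ).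
Hypothesis eB_inj : injective eB.
Context (bl : bool) (n : nat).

(** [x] is carried along unchanged: it keeps a guessed finite word for its execution after
    acceptance, and is empty for blocks. *)
Definition sim_pats x q l r w : nat * seq (pat G) :=
  (n, [:: x; cst [:: eQ q]; l; r; w]).

Definition tau_instr c c' : instr G A := (c, (None, Some c')).

(** One family for each constructor of [simstep], in the same order. Each looks at the tops of the
    stacks only, or tests them for emptiness, so prefix patterns suffice. *)
Definition sim_prog : seq (instr G A) :=
  let x := pv [::] 0 in let w := pv [::] 3 in
  fam (fun t => let: (q, a, q', b) := t in mdelta q a q' b MoveR)
    (fun t => let: (q, a, q', b) := t in
      tau_instr (sim_pats x q (pv [::] 1) (pv [:: eB a] 2) w)
                (sim_pats x q' (pv [:: eB b] 1) (pv [::] 2) w)) ++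
  fam (fun t => let: (q, a, q', b) := t in mdelta q a q' b Stay)
    (fun t => let: (q, a, q', b) := t in
      tau_instr (sim_pats x q (pv [::] 1) (pv [:: eB a] 2) w)
                (sim_pats x q' (pv [::] 1) (pv [:: eB b] 2) w)) ++
  fam (fun t => let: (q, a, q', b, d) := t in mdelta q a q' b MoveL)
    (fun t => let: (q, a, q', b, d) := t in
      tau_instr (sim_pats x q (pv [:: eB d] 1) (pv [:: eB a] 2) w)
                (sim_pats x q' (pv [::] 1) (pv [:: eB d; eB b] 2) w)) ++
  fam (fun t => let: (q, a, q', b) := t in mdelta q a q' b MoveL)
    (fun t => let: (q, a, q', b) := t in
      tau_instr (sim_pats x q (cst [::]) (pv [:: eB a] 2) w)
                (sim_pats x q' (cst [::]) (pv [:: eB b] 2) w)) ++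
  fam predT
    (fun t : mstate M * A => let: (q, a) := t in
      tau_instr (sim_pats x q (pv [::] 1) (cst [::]) (pv [:: eA a] 3))
                (sim_pats x q (pv [::] 1) (cst [:: eB (@minput _ M a)]) w)) ++
  fam (fun _ => bl)
    (fun q : mstate M =>
      tau_instr (sim_pats x q (pv [::] 1) (cst [::]) (cst [::]))
                (sim_pats x q (pv [::] 1) (cst [:: eB (mblank M)]) (cst [::]))).

Definition sim_conf x (y : sconf M) : conf G :=
  let: (q, l, r, w) := y in
  (n, [:: x; [:: eQ q]; map eB l; map eB r; map eA w]).

Lemma sim_prog_sound x y a o : astep sim_prog a (sim_conf x y) o ->
  a = None /\ exists2 y', simstep bl y y' & o = Some (sim_conf x y').
Proof.
case: y => [[[q l] r] w].
rewrite /sim_prog !astep_cat !astep_fam.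
case=> [|[|[|[|[]]]]].
- move=> [[[[q0 b] q'] c] h [v [/= -> kE ->]]]; move: kE => [].
  rewrite /peval /= => -> /eQ_inj qE <- rE <-; subst q0.
  case: r rE => [//|b' r] /= [/eB_inj -> <-]; split=> //.
  by exists (q', c :: l, r, w) => //; constructor.
- move=> [[[[q0 b] q'] c] h [v [/= -> kE ->]]]; move: kE => [].
  rewrite /peval /= => -> /eQ_inj qE <- rE <-; subst q0.
  case: r rE => [//|b' r] /= [/eB_inj -> <-]; split=> //.
  by exists (q', l, c :: r, w) => //; constructor.
- move=> [[[[[q0 b] q'] c] d] h [v [/= -> kE ->]]]; move: kE => [].
  rewrite /peval /= => -> /eQ_inj qE lE rE <-; subst q0.
  case: r rE => [//|b' r] /= [/eB_inj -> <-].
  case: l lE => [//|d' l] /= [/eB_inj -> <-]; split=> //.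
  by exists (q', l, d :: c :: r, w) => //; constructor.
- move=> [[[[q0 b] q'] c] h [v [/= -> kE ->]]]; move: kE => [].
  rewrite /peval /= => -> /eQ_inj qE lE rE <-; subst q0.
  case: r rE => [//|b' r] /= [/eB_inj -> <-].
  case: l lE => [_|//]; split=> //.
  by exists (q', [::], c :: r, w) => //; constructor.
- move=> [[q0 b] h [v [/= -> kE ->]]]; move: kE => [].
  rewrite /peval /= => -> /eQ_inj qE <- rE wE; subst q0.
  case: r rE => [_|//].
  case: w wE => [//|b' w] /= [/eA_inj -> <-]; split=> //.
  by exists (q, l, [:: @minput _ M b], w) => //; constructor.
- move=> [q0 h [v [/= -> kE ->]]]; move: kE => [].
  rewrite /peval /= => -> /eQ_inj qE <- rE wE; subst q0.
  case: r rE => [_|//]; case: w wE => [_|//]; split=> //.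
  by exists (q, l, [:: mblank M], [::]) => //; constructor.
Qed.

Lemma sim_prog_complete x y y' : simstep bl y y' ->
  astep sim_prog None (sim_conf x y) (Some (sim_conf x y')).
Proof.
pose val l r w i := nth (x : seq G) [:: x; l; r; w] i.
rewrite /sim_prog !astep_cat !astep_fam.
case=> [q a q' b l r w h|q a q' b l r w h|q a q' b d l r w h|q a q' b r w h
  |q l a w|q l h].
- left; exists (q, a, q', b) => //.
  by exists (val (map eB l) (map eB r) (map eA w)).
- right; left; exists (q, a, q', b) => //.
  by exists (val (map eB l) (map eB r) (map eA w)).
- do 2!right; left; exists (q, a, q', b, d) => //.
  by exists (val (map eB l) (map eB r) (map eA w)).
- do 3!right; left; exists (q, a, q', b) => //.
  by exists (val [::] (map eB r) (map eA w)).
- do 4!right; left; exists (q, a) => //.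
  by exists (val (map eB l) [::] (map eA w)).
- do 5!right; exists q => //.
  by exists (val (map eB l) [::] [::]).
Qed.

End Simulation.

Section Runs.
Context (G A : finType) (prog : seq (instr G A)).
Implicit Types (s : nat -> A) (u : seq A) (k : conf G).

Lemma emits_step a k k' : emits prog a k k' ->
  (exists2 k1, tau prog k k1 & emits prog a k1 k') \/
  astep prog (Some a) k (Some k').
Proof.
case=> k1 h st; have h1 := clos_rt_rt1n _ _ _ _ h.
case: h1 st => [|k2 k3 t h1] st.
  by right.
by left; exists k2 => //; exists k3 => //; exact: clos_rt1n_rt.
Qed.

Lemma taus_emits a k k1 k' : taus prog k k1 -> emits prog a k1 k' ->
  emits prog a k k'.
Proof. by move=> h [k2 h2 st]; exists k2 => //; exact: rt_trans h h2. Qed.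

Lemma live_step s i k : live prog s i k ->
  (exists2 k1, tau prog k k1 & live prog s i k1) \/
  (exists2 k1, astep prog (Some (s i)) k (Some k1) & live prog s i.+1 k1).
Proof.
move=> /liveP[k' /emits_step[[k1 t e]|e] h]; last by right; exists k'.
by left; exists k1 => //; apply/liveP; exists k'.
Qed.

Lemma taus_live s i k k1 : taus prog k k1 -> live prog s i k1 ->
  live prog s i k.
Proof.
move=> t /liveP[k' e h]; apply/liveP; exists k' => //; exact: taus_emits t e.
Qed.

Lemma taus_frun u k k1 : taus prog k k1 -> frun prog u k1 -> frun prog u k.
Proof.
case: u => [//|a u] t [[-> [k2 h st]]|[k2 e h]].
  by left; split=> //; exists k2 => //; exact: rt_trans t h.
by right; exists k2 => //; exact: taus_emits t e.
Qed.

Lemma frun_step u k : frun prog u k ->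
  (exists2 k1, tau prog k k1 & frun prog u k1) \/
  (exists a u', u = a :: u' /\
     ((exists2 k1, astep prog (Some a) k (Some k1) & frun prog u' k1) \/
      (u' = [::] /\ astep prog (Some a) k None))).
Proof.
case: u => [//|a u] [[-> [k2 h st]]|[k2 /emits_step[[k1 t e]|e] h]].
- have h1 := clos_rt_rt1n _ _ _ _ h.
  case: h1 st => [|k3 k4 t h1] st.
    by right; exists a, [::]; split=> //; right.
  left; exists k3 => //; left; split=> //; exists k4 => //; exact: clos_rt1n_rt.
- by left; exists k1 => //; right; exists k2.
- by right; exists a, u; split=> //; left; exists k2.
Qed.

End Runs.

(** * The program built from the two machines *)

Section Acceptor.
Context (A : finType) (M1 M2 : machine A).

Definition sym : finType :=
  (A + (mstate M1 + msym M1) + (mstate M2 + msym M2))%type.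

Definition eA (a : A) : sym := inl (inl a).
Definition eQ1 (q : mstate M1) : sym := inl (inr (inl q)).
Definition eB1 (b : msym M1) : sym := inl (inr (inr b)).
Definition eQ2 (q : mstate M2) : sym := inr (inl q).
Definition eB2 (b : msym M2) : sym := inr (inr b).

Lemma eA_inj : injective eA. Proof. by move=> ? ? []. Qed.
Lemma eQ1_inj : injective eQ1. Proof. by move=> ? ? []. Qed.
Lemma eB1_inj : injective eB1. Proof. by move=> ? ? []. Qed.
Lemma eQ2_inj : injective eQ2. Proof. by move=> ? ? []. Qed.
Lemma eB2_inj : injective eB2. Proof. by move=> ? ? []. Qed.

Notation instr := (instr sym A).
Notation conf := (conf sym).
Notation arg := (@pv sym [::]).

Definition tau_to n ps n' ps' : instr := tau_instr A (n, ps) (n', ps').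
Definition emit_to n ps a n' ps' : instr := (n, ps, (Some a, Some (n', ps'))).

(* Strategy names: 0 chooses a machine.  Finite words are guessed in 1, checked
   by [M1] in 2 and executed in 3.  Blocks of infinite words are guessed in 4,
   executed in 6, and then checked by [M2] in 5. *)
Definition prog0 : seq instr :=
  [:: tau_to 0 [::] 1 [:: cst [::]];
      tau_to 0 [::]
        4 [:: cst [::]; cst [:: eQ2 (mstart M2)]; cst [::]; cst [::]]].

(** The guessed word is duplicated: one copy is the input of [M1], the other is kept for the
    execution. *)
Definition prog1 : seq instr :=
  fam predT (fun a => tau_to 1 [:: arg 0] 1 [:: pv [:: eA a] 0]) ++
  [:: tau_to 1 [:: arg 0]
        2 [:: arg 0; cst [:: eQ1 (mstart M1)]; cst [::]; cst [::]; arg 0]].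

Definition prog2 : seq instr :=
  sim_prog eA eQ1 eB1 true 2 ++
  fam (mem (mfinal M1)) (fun q =>
    tau_to 2 [:: arg 0; cst [:: eQ1 q]; arg 1; arg 2; arg 3] 3 [:: arg 0]).

(** The first family may also take the last letter. This leaves the empty string, on which nothing
    fires, and hence adds no word. *)
Definition prog3 : seq instr :=
  fam predT (fun a => emit_to 3 [:: pv [:: eA a] 0] a 3 [:: arg 0]) ++
  fam predT (fun a => (3, [:: cst [:: eA a]], (Some a, None))).

(** The second family asks for a nonempty block and duplicates it: one copy is consumed by the
    execution, the other is the input of [M2]. *)
Definition prog4 : seq instr :=
  fam predT (fun a => tau_to 4 [:: arg 0; arg 1; arg 2; arg 3]
    4 [:: pv [:: eA a] 0; arg 1; arg 2; arg 3]) ++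
  fam predT (fun a => tau_to 4 [:: pv [:: eA a] 0; arg 1; arg 2; arg 3]
    6 [:: pv [:: eA a] 0; pv [:: eA a] 0; arg 1; arg 2; arg 3]).

(** The exit requires a final state and an exhausted input. As letters are read only when the head
    gets to them, the latter means that the whole block has been visited. *)
Definition prog5 : seq instr :=
  sim_prog eA eQ2 eB2 false 5 ++
  fam (mem (mfinal M2)) (fun q =>
    tau_to 5 [:: arg 0; cst [:: eQ2 q]; arg 1; arg 2; cst [::]]
      4 [:: cst [::]; cst [:: eQ2 q]; arg 1; arg 2]).

Definition prog6 : seq instr :=
  fam predT (fun a => emit_to 6 [:: pv [:: eA a] 0; arg 1; arg 2; arg 3; arg 4]
    a 6 [:: arg 0; arg 1; arg 2; arg 3; arg 4]) ++
  [:: tau_to 6 [:: cst [::]; arg 1; arg 2; arg 3; arg 4]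
        5 [:: cst [::]; arg 2; arg 3; arg 4; arg 1]].

Definition progs : seq (seq instr) :=
  [:: prog0; prog1; prog2; prog3; prog4; prog5; prog6].

Definition prog : seq instr := flatten progs.

Lemma prog_closed : all (@closed sym A) prog.
Proof.
apply/allP => i /flattenP[p pp]; move: i; apply/allP.
move: p pp; apply/allP; rewrite /= /prog1 /prog2 /prog3 /prog4 /prog5 /prog6.
by rewrite !all_cat !all_fam //; do ?case.
Qed.

Lemma prog_name n : all (fun i : instr => i.1.1 == n) (nth [::] progs n).
Proof.
case: n => [|[|[|[|[|[|[|n]]]]]]] //=; rewrite ?nth_nil // ?all_cat ?all_fam //;
  by do ?case.
Qed.

Lemma prog_at a k o :
  astep prog a k o <-> astep (nth [::] progs k.1) a k o.
Proof.
rewrite !astepE; split=> -[i ip f].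
  exists i => //; move: ip => /flattenP[p /(nthP [::])[n _ <-] ip].
  have /eqP nE := allP (prog_name n) _ ip.
  by case: f => v [_ -> _]; rewrite -nE /= in ip *.
exists i => //; apply/flattenP; exists (nth [::] progs k.1) => //.
by apply: mem_nth; case: ltnP ip => // h; rewrite nth_default.
Qed.


Notation astep := (astep prog).
Notation tau := (tau prog).
Notation taus := (taus prog).
Notation sconf1 := (sim_conf (M := M1) eA eQ1 eB1 2).
Notation sconf2 := (sim_conf (M := M2) eA eQ2 eB2 5).

Lemma taus1 k k' : tau k k' -> taus k k'.
Proof. exact: rt_step. Qed.

Lemma start_step o a : astep a (0, [::]) o -> a = None /\
  (o = Some (1, [:: [::]]) \/
   o = Some (4, [:: [::]; [:: eQ2 (mstart M2)]; [::]; [::]])).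
Proof.
by move/prog_at/astepE => [i]; rewrite /= !inE => /orP[] /eqP-> [v [-> _ ->]];
  split=> //; [left | right].
Qed.

Lemma start_fin : tau (0, [::]) (1, [:: [::]]).
Proof.
apply/prog_at/astepE; eexists; first exact: mem_head.
by exists (fun _ => [::]).
Qed.

Lemma start_inf :
  tau (0, [::]) (4, [:: [::]; [:: eQ2 (mstart M2)]; [::]; [::]]).
Proof.
apply/prog_at/astepE.
exists (tau_to 0 [::]
  4 [:: cst [::]; cst [:: eQ2 (mstart M2)]; cst [::]; cst [::]]).
  by rewrite /= /prog0 !inE eqxx orbT.
by exists (fun _ => [::]).
Qed.

(** * The branch of the finite words *)

Definition fin_inv (k : conf) : Prop :=
  [\/ exists w, k = (1, [:: map eA w]),
      exists w y, k = sconf1 (map eA w) y /\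
        sims true (mstart M1, [::], [::], w) y |
      exists2 w, k = (3, [:: map eA w]) & accepts_fin M1 w].

Lemma emit3 a w o : astep a (3, [:: map eA w]) o ->
  exists b w', [/\ a = Some b, w = b :: w' &
    o = Some (3, [:: map eA w']) \/ o = None /\ w' = [::]].
Proof.
move/prog_at; rewrite /= /prog3 astep_cat !astep_fam.
case=> -[b _ [v [/= -> [] + ->]]]; rewrite /peval /=.
  by case: w => //= c w [-> <-]; exists b, w; split=> //; left.
by case: w => //= c [|//] [->]; exists b, [::]; split=> //; right.
Qed.

Lemma fin_inv_step a k o : fin_inv k -> astep a k o ->
  (a = None /\ exists2 k', o = Some k' & fin_inv k') \/
  exists2 w, k = (3, [:: map eA w]) & accepts_fin M1 w.
Proof.
case=> [[w ->]|[w [y [-> h]]]|? _]; last by right.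
  move/prog_at; rewrite /= /prog1 astep_cat astep_fam astep1 => st; left.
  case: st => [[b _ [v [/= -> [] + ->]]]|[v [/= -> [] + ->]]];
    rewrite /peval /= => <-; split=> //; eexists; try by [].
    by apply: Or31; exists (b :: w).
  by apply: Or32; exists w; eexists; split; last exact: rt_refl.
case: y h => [[[q l] r] u] h.
move/prog_at; rewrite [nth _ _ _]/= /prog2 astep_cat astep_fam => st; left.
case: st => [st|[q' fq [v [/= -> kE ->]]]].
  have [-> [y yy ->]] :=
    sim_prog_sound eA_inj eQ1_inj eB1_inj (y := (q, l, r, u)) st.
  split=> //; eexists; first by [].
  apply: Or32; exists w, y; split=> //; apply: rt_trans h _; exact: rt_step.
case: kE; rewrite /peval /= => <- qq _ _ _; split=> //.
eexists; first by [].
apply: Or33; exists w => //; apply/accepts_finE; exists q, l, r, u.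
by split=> //; rewrite qq.
Qed.

Lemma fin_inv_taus k k' : fin_inv k -> taus k k' -> fin_inv k'.
Proof.
move=> ik h; have h1 := clos_rt_rtn1 _ _ _ _ h.
elim: h1 => [//|k1 k2 st _ IH].
case: (fin_inv_step IH st) => [[_ [k3 [<-]]]//|[w kE _]].
by rewrite /Defs.step kE in st; have [? [? []]] := emit3 st.
Qed.

Lemma frun3 w s : frun prog s (3, [:: map eA w]) -> s = w.
Proof.
elim: s w => [//|a s IH] w /frun_step[[k1 /emit3[? [? []]]]//|].
move=> [b [s' [[<- <-]]]].
case=> [[k1 /emit3[c [w' [[->] -> [[->]|[]//]]]] /IH->//]|].
by case=> -> /emit3[c [w' [[->] -> [//|[_ ->]]]]].
Qed.

Lemma fin_inv_frun k s : fin_inv k -> frun prog s k -> accepts_fin M1 s.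
Proof.
move=> ik; case: s => [//|a s].
suff h k1 o : taus k k1 -> astep (Some a) k1 o ->
    exists w, [/\ accepts_fin M1 (a :: w),
      k1 = (3, [:: map eA (a :: w)]) &
      o = Some (3, [:: map eA w]) \/ o = None /\ w = [::]].
  case=> [[-> [k1 kk1 /(h _ _ kk1)[w [ac _ [//|[_ <-]]]]]]//|].
  by case=> k' [k1 kk1 /(h _ _ kk1)[w [ac _ [[->]|[]//]]]] /frun3->.
move=> kk1 st; have ik1 := fin_inv_taus ik kk1.
case: (fin_inv_step ik1 st) => [[//]|[w k1E ac]].
rewrite k1E in st; have [b [w' [[<-] wE oE]]] := emit3 st; exists w'.
by rewrite -wE.
Qed.

(** Every emission shortens the string. *)
Lemma live3 s i w : ~ live prog s i (3, [:: map eA w]).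
Proof.
elim: w i => [|a w IH] i /live_step[[k1 /emit3[? [? []]]]//|[k1 /emit3]].
  by move=> [? [? []]].
by move=> [b [w' [_ [_ <-] [[->]|[]//]]]] /IH.
Qed.

Lemma fin_inv_live k s i : fin_inv k -> ~ live prog s i k.
Proof.
move=> ik /liveP[k' [k1 kk1 st]].
case: (fin_inv_step (fin_inv_taus ik kk1) st) => [[//]|[w k1E ac]].
rewrite k1E in st.
by have [b [w' [_ _ [[->]|[]//]]]] := emit3 st; exact: live3.
Qed.

(** The branch of the infinite words is closed under calls and has no instruction without a call, so
    it contributes no finite words. *)
Lemma inf_step a k o : (4 <= k.1)%N -> astep a k o ->
  exists2 k', o = Some k' & (4 <= k'.1)%N.
Proof.
have h n : (4 <= n)%N -> all (fun i : instr =>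
    if i.2.2 is Some c then 4 <= c.1 else false)%N (nth [::] progs n).
  case: n => [|[|[|[|[|[|[|n]]]]]]] //= _;
    rewrite ?nth_nil // ?all_cat ?all_fam //; by do ?case.
move=> /h hk /prog_at/astepE[i /(allP hk)]; case: i => [? [? [c|//]]] /= lc.
by move=> [v [_ _ ->]]; eexists.
Qed.

Lemma inf_taus k k' : (4 <= k.1)%N -> taus k k' -> (4 <= k'.1)%N.
Proof.
move=> ik h.
apply: (clos_rt_ind_left (P := fun k : conf => (4 <= k.1)%N) h ik) =>
  u v iu st.
by have [? [->]] := inf_step iu st.
Qed.

Lemma inf_frun k s : (4 <= k.1)%N -> ~ frun prog s k.
Proof.
elim: s k => [|a s IH] k ik; first by case.
case=> [[_ [k1 kk1 st]]|[k' [k1 kk1 st] hs]].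
  by have [] := inf_step (inf_taus ik kk1) st.
have [k2 [k2E] ik2] := inf_step (inf_taus ik kk1) st.
by apply: (IH k') hs; rewrite k2E.
Qed.

Lemma frun_accepts s : frun prog s (0, [::]) -> accepts_fin M1 s.
Proof.
case/frun_step => [[k1 /start_step[_ [[->]|[->]]]]|].
- by apply: fin_inv_frun; apply: Or31; exists [::].
- by move/inf_frun; case.
- by move=> [a [s' [_ [[k1]|[_]] /start_step[]]]].
Qed.

Lemma accepts_frun s : s <> [::] -> accepts_fin M1 s ->
  frun prog s (0, [::]).
Proof.
move=> s0 /accepts_finE[q [l [r [w [h fq]]]]].
apply: taus_frun (taus1 start_fin) _.
have guess : taus (1, [:: [::]]) (1, [:: map eA s]).
  elim: s {s0 h} => [|a s IH]; first exact: rt_refl.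
  apply: rt_trans IH _; apply: taus1; apply/prog_at.
  rewrite /= /prog1 astep_cat astep_fam; left; exists a => //.
  by exists (fun _ => map eA s).
apply: taus_frun guess _.
have go : tau (1, [:: map eA s])
    (sconf1 (map eA s) (mstart M1, [::], [::], s)).
  apply/prog_at; rewrite /= /prog1 astep_cat astep1; right.
  by exists (fun _ => map eA s).
apply: taus_frun (taus1 go) _.
have {}h : taus (sconf1 (map eA s) (mstart M1, [::], [::], s))
    (sconf1 (map eA s) (q, l, r, w)).
  have h1 := clos_rt_rtn1 _ _ _ _ h.
  elim: h1 => [|y y' yy' _ IH]; first exact: rt_refl.
  apply: rt_trans IH (taus1 _); apply/prog_at.
  have -> : (sconf1 (map eA s) y).1 = 2 by case: y {yy'} => [[[]]].
  by rewrite /= /prog2 astep_cat; left; apply: sim_prog_complete.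
apply: taus_frun h _.
have end_ : tau (sconf1 (map eA s) (q, l, r, w)) (3, [:: map eA s]).
  apply/prog_at; rewrite [nth _ _ _]/= /prog2 astep_cat astep_fam; right.
  exists q => //.
  by exists (nth [::] [:: map eA s; map eB1 l; map eB1 r; map eA w]).
apply: taus_frun (taus1 end_) _.
elim: s s0 {go end_} => [//|a [|b s] IH] _.
  left; split=> //; eexists; first exact: rt_refl.
  apply/prog_at; rewrite /= /prog3 astep_cat !astep_fam; right; exists a => //.
  by exists (fun _ => [::]).
right; exists (3, [:: map eA (b :: s)]); last exact: IH.
eexists; first exact: rt_refl.
apply/prog_at; rewrite [nth _ _ _]/= /prog3 astep_cat !astep_fam.
left; exists a => //.
by exists (fun _ => map eA (b :: s)).
Qed.


(** * The branch of the infinite words *)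

Definition guess_conf (u : seq A) (y : sconf M2) : conf :=
  let: (q, l, r, _) := y in
  (4, [:: map eA u; [:: eQ2 q]; map eB2 l; map eB2 r]).

Definition block_conf (u w : seq A) (y : sconf M2) : conf :=
  let: (q, l, r, _) := y in
  (6, [:: map eA u; map eA w; [:: eQ2 q]; map eB2 l; map eB2 r]).

Lemma guess_step a u y o : astep a (guess_conf u y) o ->
  a = None /\ ((exists b, o = Some (guess_conf (b :: u) y)) \/
               (u <> [::] /\ o = Some (block_conf u u y))).
Proof.
case: y => [[[q l] r] ?]; move/prog_at; rewrite /= /prog4 astep_cat !astep_fam.
case=> -[b _ [v [-> kE ->]]]; case: kE; rewrite /peval /= => kE <- <- <-;
  split=> //.
  by left; exists b; rewrite -kE.
right; case: u kE => [//|c u] [-> <-]; split=> //.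
Qed.

Lemma block_step a u w y o : astep a (block_conf u w y) o ->
  (exists b u', [/\ u = b :: u', a = Some b & o = Some (block_conf u' w y)]) \/
  [/\ u = [::], a = None & o = Some (sconf2 [::] (with_input y w))].
Proof.
case: y => [[[q l] r] ?]; move/prog_at.
rewrite [nth _ _ _]/= /prog6 astep_cat astep_fam astep1.
case=> [[b _]|] [v [-> kE ->]]; case: kE; rewrite /peval /= =>
  kE <- <- <- <-.
  by left; case: u kE => [//|c u] [-> <-]; exists b, u.
by right; case: u kE => [_|//].
Qed.

Lemma sim2_step a y o : astep a (sconf2 [::] y) o ->
  a = None /\ ((exists2 y', simstep false y y' & o = Some (sconf2 [::] y')) \/
               [/\ y.2 = [::], final y & o = Some (guess_conf [::] y)]).
Proof.
move: (y) => [[[q l] r] u]; move/prog_at.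
rewrite [nth _ _ _]/= /prog5 astep_cat astep_fam => -[st|].
  have [-> [y' yy' ->]] :=
    sim_prog_sound eA_inj eQ2_inj eB2_inj (y := (q, l, r, u)) st.
  by split=> //; left; exists y'.
move=> [q' fq [v [-> kE ->]]]; case: kE; rewrite /peval /= => _ qq <- <- uE.
by split=> //; right; rewrite /final /= qq; case: u uE.
Qed.

Lemma block_live s i u w y : live prog s i (block_conf u w y) ->
  u = seg s i (i + size u) /\
  live prog s (i + size u) (block_conf [::] w y).
Proof.
elim: u i => [|a u IH] i.
  by rewrite addn0 seg_nil.
move=> /live_step[[k1 /block_step[[? [? []]]|[]]]//|[k1 /block_step[|[]//]]].
move=> [b [u' [[<- <-] [<-] [->]]]] /IH[uE h].
rewrite /= -addSnnS; split=> //; rewrite seg_cons; last by lia.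
by congr cons.
Qed.

(** The next letter comes after finitely many silent steps, so the simulation is left before it,
    through the only exit of [prog5]. *)
Lemma sim2_live s i y : live prog s i (sconf2 [::] y) ->
  exists y', [/\ sims false y y', y'.2 = [::], final y' &
    live prog s i (guess_conf [::] y')].
Proof.
move=> /liveP[k' [k1 h st] lk'].
move: h; move kE : (sconf2 _ y) => k h; have h1 := clos_rt_rt1n _ _ _ _ h.
elim: h1 y kE st {h} => [k0|k0 k2 k3 k02 k23 IH] y kE st; subst k0.
  by have [] := sim2_step st.
have [_ [[y' yy' [k2E]]|[y2 fy [k2E]]]] := sim2_step k02; subst k2.
  have [y1 [h1 h2 h3 h4]] := IH y' erefl st; exists y1; split=> //.
  by apply: rt_trans (rt_step _ _ _ _ yy') h1.
exists y; split=> //; first exact: rt_refl.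
apply/liveP; exists k' => //; exists k3 => //; exact: clos_rt1n_rt.
Qed.

(** For the same reason guessing stops, with a nonempty block. Nothing constrains the guess itself:
    the block agrees with [s] because its letters are then emitted one by one. *)
Lemma guess_live s i y : live prog s i (guess_conf [::] y) ->
  exists j y', [/\ (i < j)%N, sims false (with_input y (seg s i j)) y',
    y'.2 = [::], final y' & live prog s j (guess_conf [::] y')].
Proof.
move=> /liveP[k' [k1 h st] lk'].
have [u u0 lu] : exists2 u, (0 < size u)%N & live prog s i (block_conf u u y).
  have h1 := clos_rt_rt1n _ _ _ _ h; move: h1 st {h}.
  move kE : (guess_conf _ y) => k h1; move: ([::] : seq A) kE => u kE.
  elim: h1 u kE => [k0|k0 k2 k3 k02 k23 IH] u kE st; subst k0.
    by have [] := guess_step st.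
  have [_ [[b [k2E]]|[u0 [k2E]]]] := guess_step k02; subst k2.
    exact: (IH _ erefl st).
  exists u; first by case: (u) u0.
  apply/liveP; exists k' => //; exists k3 => //; exact: clos_rt1n_rt.
have [uE l2] := block_live lu.
have l3 : live prog s (i + size u) (sconf2 [::] (with_input y u)).
  case/live_step: l2 => -[k2 /block_step[[? [? []]]|[]]] //.
  by move=> _ _ [->].
have [y' [h1 h2 h3 h4]] := sim2_live l3.
exists (i + size u)%N, y'; split=> //; last by rewrite -uE.
by rewrite -[ltnLHS]addn0 ltn_add2l.
Qed.

Lemma live_accepts s : live prog s 0 (0, [::]) -> accepts_inf M2 s.
Proof.
move=> /live_step[[k1 /start_step[_ [[->]|[->]]]]|[k1 /start_step[]]] // h.
  by case: (@fin_inv_live _ s 0 _ h); apply: Or31; exists [::].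
pose P (k : nat) (iy : nat * sconf M2) :=
  live prog s iy.1 (guess_conf [::] iy.2).
pose E (k : nat) (y z : nat * sconf M2) := [/\ (y.1 < z.1)%N,
  sims false (with_input y.2 (seg s y.1 z.1)) z.2, z.2.2 = [::] & final z.2].
have [||F [F0 _ FE]] := dependent_choice (P := P) (Q := E)
    (x0 := (0, initial M2)).
- exact: h.
- move=> k [i y] /guess_live[j [y' [h1 h2 h3 h4 h5]]].
  by exists (j, y').
apply: (@blocks_accepts _ _ _ (fun k => (F k).1) (fun k => (F k).2)).
by split; rewrite ?F0 // => k; exact: FE.
Qed.

Lemma guess_block u y : u <> [::] ->
  taus (guess_conf [::] y) (block_conf u u y).
Proof.
case: y => [[[q l] r] ?] u0.
have h : taus (guess_conf [::] (q, l, r, [::])) (guess_conf u (q, l, r, [::])).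
  elim: u {u0} => [|a u IH]; first exact: rt_refl.
  apply: rt_trans IH _; apply: taus1; apply/prog_at.
  rewrite /= /prog4 astep_cat !astep_fam; left; exists a => //.
  by exists (nth [::] [:: map eA u; [:: eQ2 q]; map eB2 l; map eB2 r]).
apply: rt_trans h _; apply: taus1; apply/prog_at.
case: u u0 => [//|a u] _.
rewrite /= /prog4 astep_cat !astep_fam; right; exists a => //.
by exists (nth [::] [:: map eA u; [:: eQ2 q]; map eB2 l; map eB2 r]).
Qed.

Lemma block_emit a u w y :
  astep (Some a) (block_conf (a :: u) w y) (Some (block_conf u w y)).
Proof.
case: y => [[[q l] r] ?]; apply/prog_at.
rewrite [nth _ _ _]/= /prog6 astep_cat astep_fam; left; exists a => //.
by exists (nth [::] [:: map eA u; map eA w; [:: eQ2 q]; map eB2 l; map eB2 r]).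
Qed.

Lemma run_block w y y' : sims false (with_input y w) y' -> y'.2 = [::] ->
  final y' -> taus (block_conf [::] w y) (guess_conf [::] y').
Proof.
move=> h y'2 fy'.
have t1 : tau (block_conf [::] w y) (sconf2 [::] (with_input y w)).
  case: y {h} => [[[q l] r] ?]; apply/prog_at.
  rewrite [nth _ _ _]/= /prog6 astep_cat astep1; right.
  by exists (nth [::] [:: [::]; map eA w; [:: eQ2 q]; map eB2 l; map eB2 r]).
apply: rt_trans (taus1 t1) _.
have t2 : taus (sconf2 [::] (with_input y w)) (sconf2 [::] y').
  have h1 := clos_rt_rtn1 _ _ _ _ h.
  elim: h1 => [|y1 y2 y12 _ IH]; first exact: rt_refl.
  apply: rt_trans IH (taus1 _); apply/prog_at.
  have -> : (sconf2 [::] y1).1 = 5 by case: y1 {y12} => [[[]]].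
  by rewrite /= /prog5 astep_cat; left; apply: sim_prog_complete.
apply: rt_trans t2 _; apply: taus1; apply/prog_at.
case: y' y'2 fy' {h} => [[[q l] r] u] /= -> fq.
rewrite /prog5 astep_cat astep_fam; right; exists q => //.
by exists (nth [::] [:: [::]; map eB2 l; map eB2 r]).
Qed.

Lemma accepts_live s : accepts_inf M2 s -> live prog s 0 (0, [::]).
Proof.
move=> /accepts_blocks[n [x [n0 x0 xS]]].
pose w m := seg s (n m) (n m.+1).
have w0 m : w m <> [::] by have [lt _ _ _] := xS m; rewrite /w seg_cons.
apply: taus_live (taus1 start_inf) _.
apply: (@taus_live _ _ _ _ _ _ (block_conf (w 0) (w 0) (x 0))).
  by rewrite x0; exact: (@guess_block (w 0) (initial M2)).
(* Both bounds are inclusive: [i = n m.+1] is the configuration where block [m] has been emitted but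
   not yet read by the machine. *)
pose J i k := exists m, [/\ (n m <= i)%N, (i <= n m.+1)%N &
  k = block_conf (seg s i (n m.+1)) (w m) (x m)].
have [||F [F0 _ FE]] := dependent_choice (P := J)
    (Q := fun i k k' => emits prog (s i) k k')
    (x0 := block_conf (w 0) (w 0) (x 0)).
- by exists 0; rewrite n0; split=> //; rewrite /w n0.
- move=> i k [m [mi im ->]]; have [lt h h2 h3] := xS m.
  (* At the end of a block, the silent steps before the next letter run the machine on that block
     and guess the following one. *)
  move: im; rewrite leq_eqVlt => /orP[/eqP iE|im].
    have [lt' _ _ _] := xS m.+1.
    exists (block_conf (seg s i.+1 (n m.+2)) (w m.+1) (x m.+1)).
      exists (block_conf (w m.+1) (w m.+1) (x m.+1)).
        rewrite iE seg_nil; apply: rt_trans (run_block h h2 h3) _.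
        exact: guess_block.
      by rewrite {1}/w seg_cons // -iE; exact: block_emit.
    by exists m.+1; rewrite iE.
  exists (block_conf (seg s i.+1 (n m.+1)) (w m) (x m)).
    eexists; first exact: rt_refl.
    by rewrite (@seg_cons _ _ i) //; exact: block_emit.
  by exists m; rewrite leqW.
by exists F.
Qed.

End Acceptor.

(** Rewriting is modulo the equations, so a step between some representatives of two classes is a
    step between any others. *)
Lemma step_cls_step (R : rewrite_theory) (t u : term R) :
  gterm t -> gterm u -> step_cls (cls t) (cls u) -> step t u.
Proof.
have mem (v v' : term R) : gterm v -> cls v' = cls v -> eqE v v'.
  move=> gv e; apply: ent_sym; suff: cls v' v by [].
  by rewrite e; exact: ent_refl.
move=> gt gu [t' [u' [gt' gu' te ue st]]].
by apply: step_eqE st; apply/ent_sym/mem.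
Qed.

Theorem proposition3 (R : rewrite_theory) (L : set (word (set (term R))))
    (L_exec : L `<=` executions (R := R)) (L_re : inf_re (TE (R := R)) L) :
  exists (X : extension R) (D : seq (stratdef (ext_theory X)))
         (al : strat (ext_theory X)),
    [/\ protecting X, Forall (@wf_stratdef (ext_theory X)) D, wf_strat al &
        Elang D al = wmap (emb_cls (X := X)) @` L].
Proof.
case: L_re L_exec => A [a [LA [a_inj aTE [[M1 M1P] [M2 M2P]] ->]]] L_exec.
have aE x : exists t, gterm t /\ cls t = a x.
  by have [t gt te] := aTE x; exists t.
have [tm tmP] := choice aE.
have tmg x : gterm (tm x) by have [] := tmP x.
have tmE x : cls (tm x) = a x by have [] := tmP x.
pose X := str_ext R (sym M1 M2).
have letterE x : letter (G := sym M1 M2) tm x = emb_cls (X := X) (a x).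
  by rewrite -tmE emb_cls_cls.
exists X, (defs (prog M1 M2) tm), (Call 0 [::]); split.
- exact: str_protecting.
- exact: defs_wf.
- exact: Forall_nil.
have pc := prog_closed M1 M2.
apply/seteqP; split=> [w|_ [_ [w' Lw <-] <-]].
  move=> /(Elang_sound pc tmg)
    [[s /frun_accepts/M1P sL ->]|[s /live_accepts/M2P sL ->]].
    exists (Fin (map a s)); first by exists (Fin s).
    by rewrite /= -map_comp; congr Fin; apply: eq_map => x; rewrite /= -letterE.
  exists (Inf (a \o s)); first by exists (Inf s).
  by congr Inf; apply: funext => i; rewrite /= -letterE.
(* Being an execution provides the rewriting steps between consecutive letters that [All] has to
   perform. *)
have := L_exec (wmap a w') (ex_intro2 _ _ w' Lw erefl).
case: w' Lw => s Ls.
  move=> /= [s0 _ steps].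
  have -> : Fin (map (emb_cls (X := X)) (map a s)) =
      Fin (map (letter tm) s).
    by rewrite -map_comp; congr Fin; apply: eq_map => x; rewrite /= -letterE.
  have s0' : s <> [::] by move=> e; apply: s0; rewrite e.
  apply: (Elang_fin pc tmg s0'); first by apply: accepts_frun => //; exact/M1P.
  move=> s1 b c s2 sE; apply: step_cls_step => //; rewrite !tmE.
  by apply: (steps (map a s1) _ _ (map a s2)); rewrite sE map_cat.
move=> steps.
have -> : wmap (emb_cls (X := X)) (wmap a (Inf s)) =
    Inf (letter tm \o s).
  by congr Inf; apply: funext => i; rewrite /= -letterE.
apply: (Elang_inf pc tmg); first by apply: accepts_live; exact/M2P.
by move=> i; apply: step_cls_step => //; rewrite !tmE; exact: steps.
Qed.
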